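(* The structure $\mathbb Q_{vs}^{\pi}=(\mathbb Q,\le,0,1,+,\pi\cdot)$ is not a reduct of an o-minimal trace.
   Context: In $\mathbb Q_{vs}^\pi$, the order and addition are the usual ones on $\mathbb Q$, and $\pi\cdot$ stands for the map $x\mapsto\pi x$ ($\pi=3.14159\ldots$) regarded as a definable function from $\mathbb Q$ into cuts, i.e. the language contains the binary relation $\{(x,y)\in\mathbb Q^2:\pi x<y\}$. A structure $\mathcal M$ is an o-minimal trace if there exists an o-minimal expansion $\mathcal N_0$ of an ordered group, in a language $\mathcal L_0$, such that $M\subsetneq N_0$ is dense in $N_0$, $\mathcal M|\mathcal L_0\prec\mathcal N_0$, and $\mathcal M$ is the structure induced on $M$ from $\mathcal N_0$; that is (up to a change of signature), $\mathcal M$ is $\mathcal M|\mathcal L_0$ expanded by all sets $D\cap M^n$ with $D\subseteq N_0^n$ definable (with parameters) in $\mathcal N_0$. A structure $\mathcal M'$ is a reduct of $\mathcal M$ if they have the same universe and the same order and every relation and function of $\mathcal M'$ is definable in $\mathcal M$. *)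

(* Defs.v *)
From mathcomp Require Import all_boot all_order all_algebra.
From mathcomp Require Import classical_sets reals trigo.

Set Implicit Arguments.
Unset Strict Implicit.
Unset Printing Implicit Defensive.

Import Order.TTheory GRing.Theory Num.Theory.

Local Open Scope order_scope.

(* All structures considered are expansions of a linear order: the order, like
   equality, is built into the syntax, and a language lists the other symbols.
   The carrier of a structure is an [orderType], so that two structures on the
   same [T] have the same universe and the same order. *)

Record language := Language { Fun : nat -> Type; Rel : nat -> Type }.

Inductive term (L : language) : Type :=
| Var of nat
| App n of Fun L n & ('I_n -> term L).

Inductive formula (L : language) : Type :=
| Eq of term L & term L
| Le of term L & term L
| Atom n of Rel L n & ('I_n -> term L)
| Not of formula L
| And of formula L & formula L
| Ex of nat & formula L.

Record structure (L : language) d (T : orderType d) := Structure {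
  funI : forall n, Fun L n -> ('I_n -> T) -> T;
  relI : forall n, Rel L n -> set ('I_n -> T) }.

Section Semantics.
Variables (L : language) (d : Order.disp_t) (T : orderType d).
Variable M : structure L T.

Fixpoint eval (e : nat -> T) (t : term L) : T :=
  match t with
  | Var i => e i
  | App _ f ts => funI M f (fun k => eval e (ts k))
  end.

Fixpoint sat (e : nat -> T) (phi : formula L) : Prop :=
  match phi with
  | Eq s t => eval e s = eval e t
  | Le s t => eval e s <= eval e t
  | Atom _ r ts => relI M r (fun k => eval e (ts k))
  | Not phi => ~ sat e phi
  | And phi psi => sat e phi /\ sat e psi
  | Ex i phi => exists a : T, sat [eta e with i |-> a] phi
  end.

(* The variables of index less than [n] take the values [x]; the others take
   the values [p]. *)
Definition env n (x : 'I_n -> T) (p : nat -> T) : nat -> T :=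
  fun k => if insub k is Some i then x i else p k.

(* Definability with parameters: they are the values [p i], [n <= i], of the
   finitely many other variables that occur free in [phi]. *)
Definition definable n (S : set ('I_n -> T)) : Prop :=
  exists (phi : formula L) (p : nat -> T),
    forall x : 'I_n -> T, S x <-> sat (env x p) phi.

(* A point is an interval [`[a, a]], and intervals may be unbounded; their
   endpoints, if any, are in [T]. *)
Definition o_minimal : Prop :=
  forall S : set T, definable (fun x : 'I_1 -> T => S (x ord0)) ->
  exists s : seq (interval T),
    forall x : T, S x <-> exists2 I, I \in s & x \in I.

End Semantics.

Definition graph (T : Type) n (f : ('I_n -> T) -> T) : set ('I_n.+1 -> T) :=
  fun z => f (fun i => z (widen_ord (leqnSn n) i)) = z ord_max.

Definition reduct L' L d (T : orderType d)
    (M' : structure L' T) (M : structure L T) : Prop :=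
  (forall n (f : Fun L' n), definable M (graph (funI M' f))) /\
  (forall n (r : Rel L' n), definable M (relI M' r)).

(* Not assumed to be commutative. *)
Definition ordered_group d (T : orderType d) (op : T -> T -> T) : Prop :=
  [/\ associative op,
      (exists e : T, [/\ left_id e op, right_id e op &
         forall x, exists y, op x y = e /\ op y x = e]),
      (forall z, {homo op z : x y / x <= y}) &
      (forall z, {homo op^~ z : x y / x <= y})].

Definition expands_ordered_group L d (T : orderType d) (M : structure L T) :
    Prop :=
  exists plus : Fun L 2,
    ordered_group (fun x y => funI M plus (tnth [tuple x; y])).

Definition elementary_embedding L d (T : orderType d) d' (N : orderType d')
    (M : structure L T) (M' : structure L N) (j : T -> N) : Prop :=
  forall (phi : formula L) (e : nat -> T), sat M e phi <-> sat M' (j \o e) phi.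

Section Induced.
Variables (L : language) (d d' : Order.disp_t).
Variables (T : orderType d) (N : orderType d').
Variables (M0 : structure L T) (N0 : structure L N) (j : T -> N).

Definition induced_language : language :=
  Language (Fun L)
    (fun n => (Rel L n + {D : set ('I_n -> N) | definable N0 D})%type).

Definition induced : structure induced_language T :=
  @Structure induced_language d T (fun n (f : Fun L n) => funI M0 f)
    (fun n r => match r with
                | inl r0 => relI M0 r0
                | inr D => fun x => sval D (j \o x)
                end).

End Induced.

(* The inclusion of the universe [T] in that of [N0] is the map [j], and [M0]
   is the restriction of [M] to the language of [N0]. Agreement up to a change
   of signature means that each structure is a reduct of the other. *)
Definition o_minimal_trace L d (T : orderType d) (M : structure L T) : Prop :=
  exists (L0 : language) (d' : Order.disp_t) (N : orderType d')
         (N0 : structure L0 N) (M0 : structure L0 T) (j : T -> N),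
    [/\ o_minimal N0 /\ expands_ordered_group N0,
        elementary_embedding M0 N0 j,
        (exists y : N, forall x : T, j x <> y),
        (forall a b : N, a < b -> exists x : T, a < j x < b) &
        reduct M (induced M0 N0 j) /\ reduct (induced M0 N0 j) M].

Inductive Qvs_fun : nat -> Type :=
| Qzero : Qvs_fun 0
| Qone : Qvs_fun 0
| Qplus : Qvs_fun 2.

Inductive Qvs_rel : nat -> Type :=
| Qpi : Qvs_rel 2.

Definition Qvs_pi_language : language := Language Qvs_fun Qvs_rel.

Local Open Scope ring_scope.

Definition Qvs_pi (R : realType) : structure Qvs_pi_language rat :=
  @Structure Qvs_pi_language _ rat
    (fun n (f : Qvs_fun n) =>
       match f in Qvs_fun m return ('I_m -> rat) -> rat with
       | Qzero => fun _ => 0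
       | Qone => fun _ => 1
       | Qplus => fun x => x ord0 + x ord_max
       end)
    (fun n (r : Qvs_rel n) =>
       match r in Qvs_rel m return set ('I_m -> rat) with
       | Qpi => fun x => (pi : R) * ratr (x ord0) < ratr (x ord_max)
       end).

(* Main.v *)
Require Import Defs.
From mathcomp Require Import all_boot all_order all_algebra.
From mathcomp Require Import boolp classical_sets reals trigo pi_irrational.
From mathcomp Require Import ring lra.

(** N is the universe of the o-minimal structure and j the embedding of the
    rationals in it.

    Traces on the rationals of definable sets of N0 are closed under projection,
    so that every set definable in Q_vs^pi is such a trace. In particular the sum
    of rationals is given by a family of functions definable over Q in N0, at
    some tuple t of parameters. The values at rational arguments being rational,
    hence definable over Q, they are locally constant in t as long as t is
    independent over Q; a uniformity argument allows t to be replaced by a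
    rational tuple on some box. Hence addition on a box is definable over Q.
    Multiplication by 1/pi is also a member of a family definable over Q, now of
    maps which are additive on a small interval, and its slope is irrational. By
    o-minimality and elementarity, the slopes of the additive members of this
    family fill an interval with rational endpoints. At rational slopes and
    arguments these members are true multiplications, which defines the squares
    over Q; thus some a + r sqrt(2), with a and r <> 0 rational, appears as a
    supremum definable over Q, whereas such suprema are rational. *)

Set Implicit Arguments.
Unset Strict Implicit.
Unset Printing Implicit Defensive.

Import Order.TTheory GRing.Theory Num.Theory.

(** * Definability over a set of parameters *)

Section Environments.
Variable T : Type.
Implicit Types (e : nat -> T) (v : T).

Definition scons v e : nat -> T := fun k => if k is k'.+1 then e k' else v.

Fixpoint cat_env (t : seq T) e : nat -> T :=
  if t is v :: t' then scons v (cat_env t' e) else e.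

Lemma cat_env_nth x0 t e k :
  cat_env t e k = if k < size t then nth x0 t k else e (k - size t).
Proof.
by elim: t k => [|v t IH] [|k] //=; rewrite ?subn0 // IH ltnS subSS.
Qed.

(** Variable [k] is sent either to a coordinate of [e] or to a fixed parameter; renaming and
    substitution of parameters are thus one operation. *)
Definition inst (s : nat -> nat + T) e : nat -> T :=
  fun k => match s k with inl m => e m | inr c => c end.

Definition coordinate (C : T -> Prop) (x : (nat -> T) -> T) : Prop :=
  (exists m, forall e, x e = e m) \/ (exists2 c, C c & forall e, x e = c).

Lemma coordinate_var C m : coordinate C (fun e => e m).
Proof. by left; exists m. Qed.

Lemma coordinate_cst (C : T -> Prop) c : C c -> coordinate C (fun=> c).
Proof. by right; exists c. Qed.

End Environments.

Section Definable.
Variables (L : language) (d : Order.disp_t) (T : orderType d).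
Variable M : structure L T.
Implicit Types (e : nat -> T) (t : term L) (phi : formula L).

Fixpoint ren_term (s : nat -> nat) t : term L :=
  match t with
  | Var i => Var L (s i)
  | App _ f ts => App f (fun k => ren_term s (ts k))
  end.

Lemma eval_ren s e t : eval M e (ren_term s t) = eval M (e \o s) t.
Proof.
by elim: t => //= n f ts IH; congr (funI M f); apply: funext => k.
Qed.

Lemma ord_bound n (B : 'I_n -> nat) : exists m, forall i, B i <= m.
Proof. by exists (\max_i B i) => i; apply: leq_bigmax. Qed.

Lemma eval_bound t : exists m, forall e e',
  (forall k, k < m -> e k = e' k) -> eval M e t = eval M e' t.
Proof.
elim: t => [i|n f ts /choice [B BP]]; first by exists i.+1 => e e'; apply.
have [m mP] := ord_bound B; exists m => e e' ee' /=; congr (funI M f).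
apply: funext => i; apply: BP => k kB; apply: ee'.
exact: leq_trans kB (mP i).
Qed.

(** The bound stands for the finite set of free variables: it provides fresh variables and shows
    that only finitely many parameters matter. *)
Lemma sat_bound phi : exists m, forall e e',
  (forall k, k < m -> e k = e' k) -> sat M e phi <-> sat M e' phi.
Proof.
elim: phi => [s t|s t|n r ts|phi [m IH]|phi [m IH] psi [m' IH']|i phi [m IH]].
- have [[m mP] [m' mP']] := (eval_bound s, eval_bound t).
  exists (maxn m m') => e e' ee' /=.
  rewrite (mP e e') ?(mP' e e') // => k km; apply: ee'.
    by rewrite leq_max km orbT.
  by rewrite leq_max km.
- have [[m mP] [m' mP']] := (eval_bound s, eval_bound t).
  exists (maxn m m') => e e' ee' /=.
  rewrite (mP e e') ?(mP' e e') // => k km; apply: ee'.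
    by rewrite leq_max km orbT.
  by rewrite leq_max km.
- have /choice [B BP] := fun i => eval_bound (ts i).
  have [m mP] := ord_bound B; exists m => e e' ee' /=.
  suff -> : (fun k => eval M e (ts k)) = (fun k => eval M e' (ts k)) by [].
  apply: funext => i; apply: BP => k kB; apply: ee'.
  exact: leq_trans kB (mP i).
- by exists m => e e' ee' /=; rewrite (IH e e').
- exists (maxn m m') => e e' ee' /=.
  rewrite (IH e e') ?(IH' e e') // => k km; apply: ee'.
    by rewrite leq_max km orbT.
  by rewrite leq_max km.
- exists m => e e' ee' /=; split=> -[a H]; exists a; move: H; apply IH;
    by move=> k km /=; case: eqP => // _; rewrite ee'.
Qed.

Lemma sat_ren phi s : exists psi, forall e,
  sat M e psi <-> sat M (e \o s) phi.
Proof.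
elim: phi s => [t u|t u|n r ts|phi IH|phi IH psi IH'|i phi IH] s.
- by exists (Eq (ren_term s t) (ren_term s u)) => e /=; rewrite !eval_ren.
- by exists (Le (ren_term s t) (ren_term s u)) => e /=; rewrite !eval_ren.
- exists (Atom r (fun k => ren_term s (ts k))) => e /=.
  suff -> : (fun k => eval M e (ren_term s (ts k))) =
            (fun k => eval M (e \o s) (ts k)) by [].
  by apply: funext => k; rewrite eval_ren.
- by have [psi H] := IH s; exists (Not psi) => e /=; rewrite H.
- have [[phi' H] [psi' H']] := (IH s, IH' s).
  by exists (And phi' psi') => e /=; rewrite H H'.
- have [m mP] := sat_bound phi.
  (* [w] exceeds [s k] for every [k] on which [phi] depends, so that binding it captures nothing. *)
  pose w := (\max_(k < m) s k).+1.
  have [psi H] := IH (fun k => if k == i then w else s k).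
  exists (Ex w psi) => e /=.
  have E a : sat M [eta e with w |-> a] psi <->
             sat M [eta e \o s with i |-> a] phi.
    rewrite H; apply: mP => k km /=; case: (k =P i) => _; first by rewrite eqxx.
    rewrite ifN // ltn_eqF // ltnS.
    exact: (@leq_bigmax _ (fun k : 'I_m => s k) (Ordinal km)).
  by split=> -[a /E H']; exists a.
Qed.

(** Relations are predicates on whole environments, so that they can be written as Rocq propositions
    while the formula and its parameters stay hidden. *)
Definition Def (C : T -> Prop) (P : (nat -> T) -> Prop) : Prop :=
  exists phi s, (forall k c, s k = inr c -> C c) /\
    forall e, P e <-> sat M (inst s e) phi.

End Definable.

(** * Classes of relations closed under first-order operations *)

Section Closed.
Variables (d : Order.disp_t) (T : orderType d).

(** There are two instances: the relations definable over [C], and the traces on the rationals of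
    relations definable in the o-minimal structure. As with de Bruijn indices, the quantified
    variable is number 0. *)
Record def_class (C : T -> Prop) (K : ((nat -> T) -> Prop) -> Prop) : Prop := {
  closed_not : forall P, K P -> K (fun e => ~ P e);
  closed_and : forall P Q, K P -> K Q -> K (fun e => P e /\ Q e);
  closed_scons : forall P, K P -> K (fun e => exists v, P (scons v e));
  closed_inst : forall s P, (forall k c, s k = inr c -> C c) ->
    K P -> K (fun e => P (inst s e));
  closed_eq01 : K (fun e => e 0 = e 1);
  closed_le01 : K (fun e => (e 0 <= e 1)%O) }.

Variables (C : T -> Prop) (K : ((nat -> T) -> Prop) -> Prop).
Hypothesis KC : def_class C K.
Implicit Types (P Q : (nat -> T) -> Prop) (x y z w : (nat -> T) -> T).

Lemma closed_ext P Q : (forall e, P e <-> Q e) -> K P -> K Q.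
Proof. by move=> PQ; rewrite (_ : P = Q)//; apply: funext => e; apply: propext. Qed.

Lemma closed_comp P (g : (nat -> T) -> nat -> T) :
  (forall k, coordinate C (fun e => g e k)) -> K P -> K (fun e => P (g e)).
Proof.
move=> gP KP.
have /choice [s sP] : forall k, exists a : nat + T,
    (forall c, a = inr c -> C c) /\
    forall e, g e k = match a with inl m => e m | inr c => c end.
  move=> k; case: (gP k) => [[m H]|[c Cc H]].
    by exists (inl m); split.
  by exists (inr c); split=> // c' [<-].
apply: closed_ext (closed_inst KC (s := s) _ KP) => [e|k c].
  suff -> : g e = inst s e by [].
  by apply: funext => k; rewrite (proj2 (sP k)).
exact: (proj1 (sP k)).
Qed.

Lemma closed_app1 (R : T -> Prop) x : K (fun e => R (e 0)) ->
  coordinate C x -> K (fun e => R (x e)).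
Proof.
move=> KR cx; apply: (@closed_comp _ (fun e => scons (x e) e)) KR.
by case=> [|k] //=; apply: coordinate_var.
Qed.

Lemma closed_app2 (R : T -> T -> Prop) x y : K (fun e => R (e 0) (e 1)) ->
  coordinate C x -> coordinate C y -> K (fun e => R (x e) (y e)).
Proof.
move=> KR cx cy.
apply: (@closed_comp _ (fun e => scons (x e) (scons (y e) e))) KR.
by case=> [|[|k]] //=; apply: coordinate_var.
Qed.

Lemma closed_app3 (R : T -> T -> T -> Prop) x y z :
  K (fun e => R (e 0) (e 1) (e 2)) ->
  coordinate C x -> coordinate C y -> coordinate C z ->
  K (fun e => R (x e) (y e) (z e)).
Proof.
move=> KR cx cy cz.
apply: (@closed_comp _
  (fun e => scons (x e) (scons (y e) (scons (z e) e)))) KR.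
by case=> [|[|[|k]]] //=; apply: coordinate_var.
Qed.

Lemma closed_app4 (R : T -> T -> T -> T -> Prop) x y z w :
  K (fun e => R (e 0) (e 1) (e 2) (e 3)) -> coordinate C x ->
  coordinate C y -> coordinate C z -> coordinate C w ->
  K (fun e => R (x e) (y e) (z e) (w e)).
Proof.
move=> KR cx cy cz cw.
apply: (@closed_comp _
  (fun e => scons (x e) (scons (y e) (scons (z e) (scons (w e) e))))) KR.
by case=> [|[|[|[|k]]]] //=; apply: coordinate_var.
Qed.

Lemma closed_ex (P : T -> (nat -> T) -> Prop) :
  K (fun e => P (e 0) (fun k => e k.+1)) -> K (fun e => exists v, P v e).
Proof. exact: (closed_scons KC). Qed.

Lemma closed_or P Q : K P -> K Q -> K (fun e => P e \/ Q e).
Proof.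
move=> KP KQ; apply: closed_ext (closed_not KC
  (closed_and KC (closed_not KC KP) (closed_not KC KQ))) => e.
by rewrite not_andE !not_notE.
Qed.

Lemma closed_imp P Q : K P -> K Q -> K (fun e => P e -> Q e).
Proof.
move=> KP KQ; apply: closed_ext (closed_or (closed_not KC KP) KQ) => e.
split=> [[]//|PQ]; have [/PQ|] := pselect (P e); by [right|left].
Qed.

Lemma closed_all (P : T -> (nat -> T) -> Prop) :
  K (fun e => P (e 0) (fun k => e k.+1)) -> K (fun e => forall v, P v e).
Proof.
move=> KP; apply: closed_ext (closed_not KC (closed_ex (P := fun v e => ~ P v e)
  (closed_not KC KP))) => e.
split=> [H v|H [v]]; last exact.
by apply: contrapT => nP; apply: H; exists v.
Qed.

Lemma closed_eq x y : coordinate C x -> coordinate C y ->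
  K (fun e => x e = y e).
Proof. exact: (@closed_app2 eq x y (closed_eq01 KC)). Qed.

Lemma closed_le x y : coordinate C x -> coordinate C y ->
  K (fun e => (x e <= y e)%O).
Proof.
exact: (@closed_app2 (fun a b => is_true (a <= b)%O) x y (closed_le01 KC)).
Qed.

Lemma closed_lt x y : coordinate C x -> coordinate C y ->
  K (fun e => (x e < y e)%O).
Proof.
move=> cx cy; apply: closed_ext (closed_not KC (closed_le cy cx)) => e.
by rewrite ltNge; split=> /negP.
Qed.

Lemma closed_cat n P : K P ->
  K (fun e => exists t, size t = n /\ P (cat_env t e)).
Proof.
elim: n P => [|n IH] P KP.
  apply: closed_ext KP => e; split=> [Pe|[t [/size0nil ->]]//].
  by exists [::].
apply: closed_ext (IH _ (closed_scons KC KP)) => e; split.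
  by move=> [t [tn [v Pv]]]; exists (v :: t); rewrite /= tn.
by move=> [[|v t] [] //= [tn] Pv]; exists t; split=> //; exists v.
Qed.

Lemma closed_ord n (P : 'I_n -> (nat -> T) -> Prop) : (forall i, K (P i)) ->
  K (fun e => forall i, P i e).
Proof.
elim: n P => [|n IH] P KP.
  apply: closed_ext (closed_imp (closed_eq01 KC) (closed_eq01 KC)) => e.
  by split=> // _ [].
have KP' := closed_and KC (KP ord0) (IH (fun i => P (lift ord0 i))
  (fun i => KP _)).
apply: closed_ext KP' => e; split=> [[P0 Pl] i|H]; last by [].
by case: (unliftP ord0 i) => [k ->|->].
Qed.

(** Induction on formulas, from the symbols alone. The values of nested terms are named by
    quantified variables, so that functions occur only through their graphs. *)
Lemma closed_sat L (M : structure L T) :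
  (forall n (f : Fun L n), K (fun e => funI M f (fun i => e i) = e n)) ->
  (forall n (r : Rel L n), K (fun e => relI M r (fun i => e i))) ->
  forall phi, K (fun e => sat M e phi).
Proof.
move=> KF KR.
(* The value of the term sits at variable 0, and the variables of the term are shifted by one. *)
have KE (t : term L) : K (fun e => eval M (fun k => e k.+1) t = e 0).
  elim: t => [i|n f ts IH] /=.
    by apply: closed_eq; apply: coordinate_var.
  have Kn i : K (fun e => eval M (fun k => e (n + k.+1)) (ts i) = e i).
    apply: (@closed_comp _ (fun e k => if k is k'.+1 then e (n + k'.+1) else e i)
      _ (IH i)) => -[|k]; apply: coordinate_var.
  have KFn : K (fun e => funI M f (fun i => e i) = e (n + 0)).
    by rewrite addn0; apply: KF.
  (* Variables below [n] hold the values of the arguments; the original environment comes after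
     them. *)
  apply: closed_ext (closed_cat n (closed_and KC KFn (closed_ord Kn))) => e.
  split=> [[t [tn [H0 H]]]|H0].
    have <- : cat_env t e (n + 0) = e 0.
      by rewrite (cat_env_nth (e 0)) tn addn0 ltnn subnn.
    rewrite -H0; congr (funI M f); apply: funext => i; rewrite -(H i).
    congr (eval M _ _); apply: funext => k.
    by rewrite (cat_env_nth (e 0)) tn ltnNge leq_addr /= addKn.
  pose v i := eval M (fun k => e k.+1) (ts i).
  have vs : size (map v (enum 'I_n)) = n by rewrite size_map size_enum_ord.
  have E (i : 'I_n) : cat_env (map v (enum 'I_n)) e i = v i.
    by rewrite (cat_env_nth (e 0)) vs ltn_ord (nth_map i) ?size_enum_ord //
      nth_ord_enum.
  exists (map v (enum 'I_n)); split=> //; split.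
    rewrite (cat_env_nth (e 0)) vs addn0 ltnn subnn -H0.
    by congr (funI M f); apply: funext => i; rewrite E.
  move=> i; rewrite E; congr (eval M _ _); apply: funext => k.
  by rewrite (cat_env_nth (e 0)) vs ltnNge leq_addr /= addKn.
elim=> [s t|s t|n r ts|phi IH|phi IH psi IH'|i phi IH] /=.
- have KP := @closed_ex (fun v e => eval M e s = v /\ eval M e t = v)
    (closed_and KC (KE s) (KE t)).
  apply: closed_ext KP => e.
  by split=> [[v [-> ->]]//|st]; exists (eval M e s).
- have ce m : coordinate C (fun e : nat -> T => e m) by apply: coordinate_var.
  have K1 := @closed_comp _ (fun e k => e k.+1) (fun k => ce _) (KE s).
  have K2 := @closed_comp _ (fun e k => if k is 0 then e 0 else e k.+1)
    (fun k => if k is 0 then ce _ else ce _) (KE t).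
  have KP := closed_and KC K1 (closed_and KC K2 (closed_le (ce 1) (ce 0))).
  apply: closed_ext (closed_scons KC (closed_scons KC KP)) => e /=.
  by split=> [[v [w [-> [->]]]]|]; last exists (eval M e s), (eval M e t).
- pose v e i := eval M e (ts i).
  apply: closed_ext (closed_cat n (closed_and KC (KR n r) (closed_ord
    (P := fun i e => eval M (fun k => e (n + k)) (ts i) = e i) _))) => [e|i].
    split=> [[t [tn [H Ht]]]|H].
      move: H; congr (relI M r _); apply: funext => i; rewrite -(Ht i).
      congr (eval M _ _); apply: funext => k.
      by rewrite (cat_env_nth (e 0)) tn ltnNge leq_addr /= addKn.
    have vs : size (map (v e) (enum 'I_n)) = n by rewrite size_map size_enum_ord.
    have E (i : 'I_n) : cat_env (map (v e) (enum 'I_n)) e i = v e i.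
      by rewrite (cat_env_nth (e 0)) vs ltn_ord (nth_map i) ?size_enum_ord //
        nth_ord_enum.
    exists (map (v e) (enum 'I_n)); split=> //; split.
      by move: H; congr (relI M r _); apply: funext => i; rewrite E.
    move=> i; rewrite E; congr (eval M _ _); apply: funext => k.
    by rewrite (cat_env_nth (e 0)) vs ltnNge leq_addr /= addKn.
  apply: (@closed_comp _ (fun e k => if k is k'.+1 then e (n + k') else e i)
    _ (KE (ts i))) => -[|k]; apply: coordinate_var.
- exact: (closed_not KC).
- exact: (closed_and KC).
- apply: closed_ext (@closed_ex (fun v e => sat M [eta e with i |-> v] phi)
    (@closed_comp _ (fun e k => if k == i then e 0 else e k.+1) _ IH)) => // k.
  by case: eqP => _; apply: coordinate_var.
Qed.

End Closed.

Local Open Scope order_scope.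

(** * Calculus of definable relations and their parameters *)

Section DefTheory.
Variables (L : language) (d : Order.disp_t) (T : orderType d).
Variable M : structure L T.

Lemma Def_mono (C C' : T -> Prop) P : (forall c, C c -> C' c) ->
  Def M C P -> Def M C' P.
Proof.
by move=> CC [phi [s [sC H]]]; exists phi, s; split=> // k c /sC /CC.
Qed.

Lemma Def_closed C : def_class C (Def M C).
Proof.
split.
- move=> P [phi [s [sC H]]]; exists (Not phi), s; split=> // e /=.
  by rewrite H.
- move=> P P' [phi [s [sC H]]] [phi' [s' [sC' H']]].
  (* Even variables serve [phi] and odd ones [phi'], so that the two instantiations do not clash. *)
  have [psi E] := sat_ren M phi double.
  have [psi' E'] := sat_ren M phi' (fun k => k.*2.+1).
  exists (And psi psi'), (fun k => if odd k then s' k./2 else s k./2).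
  split=> [k c|e /=]; first by case: ifP => _; [apply: sC'|apply: sC].
  rewrite E E' H H'.
  suff [-> ->] : inst (fun k => if odd k then s' k./2 else s k./2) e \o double =
    inst s e /\ inst (fun k => if odd k then s' k./2 else s k./2) e \o
    (fun k => k.*2.+1) = inst s' e by [].
  by split; apply: funext => k; rewrite /inst /= odd_double ?uphalf_double ?doubleK.
- move=> P [phi [s [sC H]]].
  (* All variables that are sent to coordinate 0 are merged into variable 0, which can then be
     quantified. *)
  have [psi E] := sat_ren M phi (fun k => if s k is inl 0%N then 0 else k.+1).
  exists (Ex 0 psi), (fun k => if k is k'.+1 then
    match s k' with inl m => inl m.-1 | inr c => inr c end else inl 0).
  split=> [[//|k] c|e /=].
    by case sk: (s k) => [//|c'] [<-]; apply: sC sk.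
  set e' := inst _ e.
  have F v : P (scons v e) <-> sat M [eta e' with 0%N |-> v] psi.
    rewrite E H.
    suff -> : inst s (scons v e) = [eta e' with 0%N |-> v] \o
      (fun k => if s k is inl 0%N then 0%N else k.+1) by [].
    apply: funext => k; rewrite /e' /inst /=.
    by case sk: (s k) => [[|m]|c]; rewrite //= sk.
  by split=> -[v /F Pv]; exists v.
- move=> s P sC [phi [s' [sC' H]]].
  exists phi, (fun k => match s' k with inl m => s m | inr c => inr c end).
  split=> [k c|e]; first by case sk: (s' k) => [m|c'];
    [apply: sC|case=> <-; apply: sC' sk].
  rewrite H.
  suff -> : inst s' (inst s e) = inst (fun k =>
    match s' k with inl m => s m | inr c => inr c end) e by [].
  by apply: funext => k; rewrite /inst; case: (s' k).
- by exists (Eq (Var L 0) (Var L 1)), inl; split.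
- by exists (Le (Var L 0) (Var L 1)), inl; split.
Qed.

Definition Def1 C (R : T -> Prop) := Def M C (fun e => R (e 0%N)).
Definition Def2 C (R : T -> T -> Prop) := Def M C (fun e => R (e 0%N) (e 1%N)).
Definition Def3 C (R : T -> T -> T -> Prop) :=
  Def M C (fun e => R (e 0%N) (e 1%N) (e 2%N)).
Definition Def4 C (R : T -> T -> T -> T -> Prop) :=
  Def M C (fun e => R (e 0%N) (e 1%N) (e 2%N) (e 3%N)).

Lemma Def1_app C R (x : (nat -> T) -> T) : Def1 C R -> coordinate C x ->
  Def M C (fun e => R (x e)).
Proof. exact: (@closed_app1 _ _ _ _ (Def_closed C) R). Qed.

Lemma Def2_app C R (x y : (nat -> T) -> T) : Def2 C R -> coordinate C x ->
  coordinate C y ->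
  Def M C (fun e => R (x e) (y e)).
Proof. exact: (@closed_app2 _ _ _ _ (Def_closed C) R). Qed.

Lemma Def3_app C R (x y z : (nat -> T) -> T) : Def3 C R -> coordinate C x ->
  coordinate C y ->
  coordinate C z -> Def M C (fun e => R (x e) (y e) (z e)).
Proof. exact: (@closed_app3 _ _ _ _ (Def_closed C) R). Qed.

Lemma Def4_app C R (x y z w : (nat -> T) -> T) : Def4 C R -> coordinate C x ->
  coordinate C y -> coordinate C z -> coordinate C w ->
  Def M C (fun e => R (x e) (y e) (z e) (w e)).
Proof. exact: (@closed_app4 _ _ _ _ (Def_closed C) R). Qed.

Lemma Def_comp C P (g : (nat -> T) -> nat -> T) :
  (forall k, coordinate C (fun e => g e k)) -> Def M C P ->
  Def M C (fun e => P (g e)).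
Proof. exact: (closed_comp (Def_closed C)). Qed.

Lemma Def_ext C P Q : (forall e, P e <-> Q e) -> Def M C P -> Def M C Q.
Proof. exact: (closed_ext (K := Def M C)). Qed.

Lemma Def_const C A : Def M C (fun=> A).
Proof.
have KC := Def_closed C; have K01 := closed_eq01 KC.
have [a|na] := pselect A.
  by apply: Def_ext (closed_imp KC K01 K01) => e; split.
by apply: Def_ext (closed_and KC K01 (closed_not KC K01)) => e; split=> // -[].
Qed.

(** The parameter [p] is traded for a new first variable. Parameters that lie in [C] are kept; any
    other one must be [p]. *)
Lemma Def_split (C : T -> Prop) p P (C0 : exists c, C c) :
  Def M (fun x => x = p \/ C x) P ->
  exists2 P', Def M C P' & forall e, P e <-> P' (scons p e).
Proof.
move=> [phi [s [sC H]]].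
pose s' k := match s k with
  inl m => inl m.+1 | inr c => if pselect (C c) then inr c else inl 0%N end.
exists (fun e => sat M (inst s' e) phi).
  exists phi, s'; split=> // k c; rewrite /s'.
  by case: (s k) => // c'; case: pselect => // Cc [<-].
move=> e; rewrite H; set e1 := inst _ _; set e2 := inst _ _.
suff -> : e1 = e2 by [].
apply: funext => k; rewrite /e1 /e2 /inst /s'.
case sk: (s k) => [//|c]; case: pselect => //= nC.
by case: (sC _ _ sk).
Qed.

(** Only the parameters placed below a bound of the formula matter. Variables beyond it are all sent
    to a single element [c0] of [C']. *)
Lemma Def_finite (C0 : exists c : T, True) C P : Def M C P -> exists l : seq T,
  (forall c, c \in l -> C c) /\ forall C', (exists c, C' c) ->
    (forall c, c \in l -> C' c) -> Def M C' P.
Proof.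
move=> [phi [s [sC H]]]; have [m mP] := sat_bound M phi.
pose l := pmap (fun k => if s k is inr c then Some c else None) (iota 0 m).
have lP c : c \in l <-> exists2 k, (k < m)%N & s k = inr c.
  rewrite mem_pmap; split=> [/mapP [k]|[k km sk]].
    rewrite mem_iota => km; case sk: (s k) => // -[->].
    by exists k.
  by apply/mapP; exists k; rewrite ?sk // mem_iota.
exists l; split=> [c /lP [k _ /sC] //|C' [c0 C'c0] lC].
exists phi, (fun k => if (k < m)%N then s k else inr c0); split.
  move=> k c; case: ifP => km; last by case=> <-.
  by move=> sk; apply/lC/lP; exists k.
by move=> e; rewrite H; apply: mP => k km; rewrite /inst km.
Qed.

End DefTheory.

Ltac coord := first
  [ exact: coordinate_var
  | apply: coordinate_cst;
    first [exact: I | done | by left; eexists | by right | idtac] ].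

(* Atoms are looked up among the hypotheses [Def1], ..., [Def4]; those that are
   not found there are left as subgoals. *)
Ltac def := cbv beta; lazymatch goal with
  | |- Def ?M ?C (fun e => ~ (@?P e)) =>
      refine (closed_not (Def_closed M C) (P := P) _); def
  | |- Def ?M ?C (fun e => (@?P e) /\ (@?Q e)) =>
      refine (closed_and (Def_closed M C) (P := P) (Q := Q) _ _); def
  | |- Def ?M ?C (fun e => (@?P e) \/ (@?Q e)) =>
      refine (closed_or (Def_closed M C) (P := P) (Q := Q) _ _); def
  | |- Def ?M ?C (fun e => (@?P e) -> (@?Q e)) =>
      refine (closed_imp (Def_closed M C) (P := P) (Q := Q) _ _); def
  | |- Def ?M ?C (fun e => exists v, @?P e v) =>
      refine (closed_ex (Def_closed M C) (P := fun v e => P e v) _); def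
  | |- Def ?M ?C (fun e => forall v, @?P e v) =>
      refine (closed_all (Def_closed M C) (P := fun v e => P e v) _); def
  | |- Def ?M ?C (fun e => (@?x e) = (@?y e)) =>
      refine (closed_eq (Def_closed M C) (x := x) (y := y) _ _); coord
  | |- Def ?M ?C (fun e => is_true ((@?x e) <= (@?y e))) =>
      refine (closed_le (Def_closed M C) (x := x) (y := y) _ _); coord
  | |- Def ?M ?C (fun e => is_true ((@?x e) < (@?y e))) =>
      refine (closed_lt (Def_closed M C) (x := x) (y := y) _ _); coord
  | |- _ => try match goal with
    | H : Def4 _ _ ?R |- Def _ _ (fun e => ?R (@?x e) (@?y e) (@?z e) (@?w e)) =>
        refine (Def4_app (x := x) (y := y) (z := z) (w := w) H _ _ _ _); coord
    | H : Def3 _ _ ?R |- Def _ _ (fun e => ?R (@?x e) (@?y e) (@?z e)) =>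
        refine (Def3_app (x := x) (y := y) (z := z) H _ _ _); coord
    | H : Def2 _ _ ?R |- Def _ _ (fun e => ?R (@?x e) (@?y e)) =>
        refine (Def2_app (x := x) (y := y) H _ _); coord
    | H : Def1 _ _ ?R |- Def _ _ (fun e => ?R (@?x e)) =>
        refine (Def1_app (x := x) H _); coord
    | |- Def _ _ (fun=> _) => exact: Def_const
    end
  end.

(** * Finite unions of intervals *)

(** The quantifiers range over points only, so that the supremum of a definable family is definable
    over the same parameters. *)
Definition is_sup d (T : orderType d) (A : T -> Prop) z :=
  (forall x, A x -> x <= z) /\ (forall w, w < z -> exists x, A x /\ w < x).

Lemma is_sup_unique d (T : orderType d) (A : T -> Prop) z z' :
  is_sup A z -> is_sup A z' -> z = z'.
Proof.
move=> [zA Az] [zA' Az']; apply/eqP; rewrite eq_le !leNgt; apply/andP; split.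
  by apply/negP => /Az [x [/zA' /le_lt_trans /[apply]]]; rewrite ltxx.
by apply/negP => /Az' [x [/zA /le_lt_trans /[apply]]]; rewrite ltxx.
Qed.

Section Tame.
Variables (d : Order.disp_t) (N : orderType d) (j : rat -> N).
Hypothesis dense : forall a b : N, a < b -> exists q, a < j q < b.
Hypothesis cofinal : forall a : N, exists q, a < j q.
Hypothesis coinitial : forall a : N, exists q, j q < a.

Definition tame (A : N -> Prop) : Prop :=
  exists s : seq (interval N), forall x, A x <-> exists2 I, I \in s & x \in I.

Lemma itv_convex (I : interval N) x y z : x \in I -> y \in I -> x < z < y ->
  z \in I.
Proof.
case: I => l u; rewrite !itv_boundlr => /andP [lx xu] /andP [ly yu] /andP [xz zy].
rewrite (le_trans lx) ?(le_trans _ yu) // ?bnd_simp; exact: ltW.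
Qed.

(** An interval of the union either misses some []a, c[] or has points arbitrarily close to [a] on
    its right; in the second case convexity puts some []a, y[] inside it. *)
Lemma tame_germ_right A a : tame A -> exists2 b, a < b &
  (forall x, a < x < b -> A x) \/ (forall x, a < x < b -> ~ A x).
Proof.
move=> [s sP]; suff [b ab H] : exists2 b, a < b &
    (forall x, a < x < b -> exists2 I, I \in s & x \in I) \/
    (forall x, a < x < b -> ~ exists2 I, I \in s & x \in I).
  by exists b => //; case: H => H; [left|right] => x /H; rewrite sP.
elim: s {sP} => [|I s [b ab [H|H]]].
- by have [q aq] := cofinal a; exists (j q) => //; right => x _ [].
- exists b => //; left => x /H [I' I's xI']; exists I' => //.
  by rewrite inE I's orbT.
- have [[c ac cI]|nI] := pselect (exists2 c, a < c & forall x, a < x < c -> x \notin I).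
    exists (Order.min b c); first by rewrite lt_min ab.
    right => x; rewrite lt_min => /and3P [ax xb xc] [I']; rewrite inE.
    case/orP => [/eqP -> xI|I's xI']; last by apply: (H x); [rewrite ax|exists I'].
    by have := cI x; rewrite ax xc xI => /(_ isT).
  have meet c : a < c -> exists2 x, a < x < c & x \in I.
    move=> ac; apply: contrapT => nx; apply: nI; exists c => // x axc.
    by apply/negP => xI; apply: nx; exists x.
  have [y /andP [ay yb] yI] := meet b ab.
  exists y => //; left => x /andP [ax xy]; exists I; first exact: mem_head.
  have [w /andP [aw wx] wI] := meet x ax.
  by apply: itv_convex wI yI _; rewrite wx.
Qed.

Lemma tame_germ_left A a : tame A -> exists2 b, b < a &
  (forall x, b < x < a -> A x) \/ (forall x, b < x < a -> ~ A x).
Proof.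
move=> [s sP]; suff [b ab H] : exists2 b, b < a &
    (forall x, b < x < a -> exists2 I, I \in s & x \in I) \/
    (forall x, b < x < a -> ~ exists2 I, I \in s & x \in I).
  by exists b => //; case: H => H; [left|right] => x /H; rewrite sP.
elim: s {sP} => [|I s [b ab [H|H]]].
- by have [q aq] := coinitial a; exists (j q) => //; right => x _ [].
- exists b => //; left => x /H [I' I's xI']; exists I' => //.
  by rewrite inE I's orbT.
- have [[c ac cI]|nI] := pselect (exists2 c, c < a & forall x, c < x < a -> x \notin I).
    exists (Order.max b c); first by rewrite gt_max ab.
    right => x; rewrite gt_max => /andP [/andP [bx cx] xa] [I']; rewrite inE.
    case/orP => [/eqP -> xI|I's xI']; last by apply: (H x); [rewrite bx|exists I'].
    by have := cI x; rewrite cx xa xI => /(_ isT).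
  have meet c : c < a -> exists2 x, c < x < a & x \in I.
    move=> ac; apply: contrapT => nx; apply: nI; exists c => // x axc.
    by apply/negP => xI; apply: nx; exists x.
  have [y /andP [by_ ya] yI] := meet b ab.
  exists y => //; left => x /andP [yx xa]; exists I; first exact: mem_head.
  have [w /andP [xw wa] wI] := meet x xa.
  by apply: itv_convex yI wI _; rewrite yx.
Qed.

(** Of the two possible germs, density of the rationals excludes the negative one. This extends to
    [N] what is known at rational points only. *)
Lemma tame_right A a b : tame A -> a < b ->
  (forall q, a < j q < b -> A (j q)) ->
  exists2 c, a < c & forall x, a < x < c -> A x.
Proof.
move=> tA ab H; have [c ac [cA|cA]] := tame_germ_right a tA; first by exists c.
have [|q] := @dense a (Order.min b c); first by rewrite lt_min ab.
rewrite lt_min => /and3P [aq qb qc].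
by case: (cA (j q)); rewrite ?aq //; apply: H; rewrite aq.
Qed.

Lemma tame_left A a b : tame A -> b < a ->
  (forall q, b < j q < a -> A (j q)) ->
  exists2 c, c < a & forall x, c < x < a -> A x.
Proof.
move=> tA ab H; have [c ac [cA|cA]] := tame_germ_left a tA; first by exists c.
have [|q] := @dense (Order.max b c) a; first by rewrite gt_max ab.
rewrite gt_max => /andP [/andP [bq cq] qa].
by case: (cA (j q)); rewrite ?cq //; apply: H; rewrite bq.
Qed.

(** If a point [x] of an interval of the union lay above the left endpoint [a], then []a, x[] would
    be contained in [A]; hence [x] is that endpoint. *)
Lemma tame_finite A : tame A ->
  (forall a b, a < b -> ~ forall x, a < x < b -> A x) ->
  exists r : seq N, forall x, A x -> x \in r.
Proof.
move=> [s sP] nA.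
exists (pmap (fun I : interval N => if I is Interval (BSide _ a) _ then Some a
  else None) s) => x /sP [I Is xI]; rewrite mem_pmap; apply/mapP; exists I => //.
have sub a : a < x -> ~ (forall y, a < y < x -> y \in I).
  by move=> /nA ax H; apply: ax => y /H yI; apply/sP; exists I.
case: I Is xI sub => [[b a|[]] u] Is; rewrite itv_boundlr => /andP [ax xu] sub //.
  have {ax} ax : a <= x by case: b ax {Is sub}; rewrite bnd_simp // => /ltW.
  move: ax; rewrite le_eqVlt => /orP [/eqP -> //|ax].
  case: (sub a ax) => y /andP [ay yx]; rewrite itv_boundlr (le_trans _ xu) ?andbT.
    by case: b {Is sub}; rewrite bnd_simp // ltW.
  by rewrite bnd_simp ltW.
have [q qx] := coinitial x.
case: (sub _ qx) => y /andP [_ yx]; rewrite itv_boundlr (le_trans _ xu) //.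
by rewrite bnd_simp ltW.
Qed.

Lemma avoid_right (r : seq N) a b : a < b ->
  exists q, a < j q < b /\ forall x, x \in r -> ~ a < x <= j q.
Proof.
move=> ab; elim: r => [|x r [q [/andP [aq qb] qr]]].
  by have [q aqb] := dense ab; exists q.
have [/andP [ax xq]|nx] := boolP (a < x <= j q).
  have [q' /andP [aq' q'x]] := dense ax.
  have q'q := lt_le_trans q'x xq.
  exists q'; rewrite aq' (lt_trans q'q) //; split=> // y; rewrite inE.
  case/orP => [/eqP -> /andP [_]|/qr yq /andP [ay yq']]; first by rewrite leNgt q'x.
  by apply: yq; rewrite ay (le_trans yq') // ltW.
exists q; rewrite aq qb; split=> // y; rewrite inE.
by case/orP => [/eqP ->|/qr //]; apply/negP.
Qed.

Lemma avoid_left (r : seq N) a b : b < a ->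
  exists q, b < j q < a /\ forall x, x \in r -> ~ j q <= x < a.
Proof.
move=> ab; elim: r => [|x r [q [/andP [bq qa] qr]]].
  by have [q aqb] := dense ab; exists q.
have [/andP [qx xa]|nx] := boolP (j q <= x < a).
  have [q' /andP [xq' q'a]] := dense xa.
  have q'q := le_lt_trans qx xq'.
  exists q'; rewrite q'a (lt_trans bq) //; split=> // y; rewrite inE.
  case/orP => [/eqP -> /andP []|/qr yq /andP [ay yq']]; first by rewrite leNgt xq'.
  by apply: yq; rewrite yq' (le_trans _ ay) // ltW.
exists q; rewrite bq qa; split=> // y; rewrite inE.
by case/orP => [/eqP ->|/qr //]; apply/negP.
Qed.

Lemma itv_sup (I : interval N) x b : x \in I -> (forall y, y \in I -> y <= b) ->
  exists z, is_sup (fun y => y \in I) z.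
Proof.
case: I => l [[] z|[]] xI ub; move: (xI); rewrite itv_boundlr => /andP [lx xz] //.
- exists z; split=> [y|w wz].
    by rewrite itv_boundlr => /andP [_]; rewrite bnd_simp => /ltW.
  rewrite bnd_simp in xz.
  have [|q] := @dense (Order.max w x) z; first by rewrite gt_max wz.
  rewrite gt_max => /andP [/andP [wq xq] qz].
  exists (j q); split=> //; rewrite itv_boundlr (le_trans lx) ?bnd_simp //=.
  exact: ltW.
- exists z; split=> [y|w wz].
    by rewrite itv_boundlr => /andP [_]; rewrite bnd_simp.
  rewrite bnd_simp in xz.
  by exists z; split=> //; rewrite itv_boundlr (le_trans lx) ?bnd_simp.
- have [q] := cofinal (Order.max x b); rewrite gt_max => /andP [xq bq].
  suff : j q <= b by rewrite leNgt bq.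
  by apply: ub; rewrite itv_boundlr (le_trans lx) ?bnd_simp // ltW.
Qed.

(** The supremum of the union is the greatest of the suprema of its nonempty intervals, which exist
    in [N] because their endpoints do. *)
Lemma tame_sup A x0 b : tame A -> A x0 -> (forall x, A x -> x <= b) ->
  exists z, is_sup A z.
Proof.
move=> [s sP] Ax0 ub.
have {Ax0} ne : exists x, exists2 I, I \in s & x \in I by exists x0; apply/sP.
have {ub} ub x : (exists2 I, I \in s & x \in I) -> x <= b by move/sP/ub.
suff [z [z1 z2]] : exists z, is_sup (fun x => exists2 I, I \in s & x \in I) z.
  exists z; split=> [x /sP /z1 //|w /z2 [x [xs wx]]].
  by exists x; rewrite sP.
elim: s {sP} ne ub => [[? []//]|I s IH] ne ub.
have ubI x : x \in I -> x <= b.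
  by move=> xI; apply: ub; exists I => //; apply: mem_head.
have ubs x : (exists2 I, I \in s & x \in I) -> x <= b.
  by move=> [J Js xJ]; apply: ub; exists J => //; rewrite inE Js orbT.
have [[x xI]|nI] := pselect (exists x, x \in I); last first.
  have [|z [z1 z2]] := IH _ ubs.
    case: ne => x [J]; rewrite inE => /orP [/eqP -> xI|Js xJ]; last by exists x, J.
    by case: nI; exists x.
  exists z; split=> [x [J]|w /z2 [x [[J Js xJ] wx]]].
    rewrite inE => /orP [/eqP -> xI|Js xJ]; first by case: nI; exists x.
    by apply: z1; exists J.
  by exists x; split=> //; exists J => //; rewrite inE Js orbT.
have [z [z1 z2]] := itv_sup xI ubI.
have [nes|nes] := pselect (exists x, exists2 I, I \in s & x \in I); last first.
  exists z; split=> [y [J]|w /z2 [y [yI wy]]].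
    rewrite inE => /orP [/eqP -> /z1 //|Js yJ].
    by case: nes; exists y, J.
  by exists y; split=> //; exists I => //; apply: mem_head.
have [z' [z1' z2']] := IH nes ubs.
exists (Order.max z z'); split=> [y [J]|w].
  rewrite inE le_max => /orP [/eqP -> /z1 -> //|Js yJ].
  by rewrite z1' ?orbT //; exists J.
rewrite lt_max => /orP [/z2 [y [yI wy]]|/z2' [y [[J Js yJ] wy]]]; exists y.
  by split=> //; exists I => //; apply: mem_head.
by split=> //; exists J => //; rewrite inE Js orbT.
Qed.

End Tame.

(** * Additive maps between rationals *)

Section Rational.
Local Open Scope ring_scope.

Lemma sqr_rat_neq2 (x : rat) : x ^+ 2 <> 2.
Proof.
move=> x2.
have den0 : (denq x)%:~R != 0 :> rat by rewrite intr_eq0 denq_eq0.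
have : (numq x) ^+ 2 = 2 * (denq x) ^+ 2.
  apply: (intr_inj (R := rat)); rewrite !expr2 !intrM numqE mulrACA -[x * x]expr2 x2 //.
move=> /(congr1 absz); rewrite abszM !abszX.
set m := `|numq x|%N; set n := `|denq x|%N => mn.
have n0 : (0 < n)%N by rewrite absz_gt0 denq_eq0.
have m0 : (0 < m)%N.
  by rewrite lt0n; apply/eqP => m0; move: mn n0; rewrite m0 /=; case: n.
(* The exponent of 2 is even in [m ^ 2] and odd in [2 * n ^ 2]. *)
have := congr1 (fun k => odd (logn 2 k)) mn.
by rewrite /= lognM ?expn_gt0 ?n0 // !lognX lognE /= !oddM.
Qed.

(** Two rationals are commensurable: [x] and [l] are integral multiples [t * m] and [t * n] of the
    same [t], and additivity gives [g] at both from [g t]. *)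
Lemma additive_linear (g : rat -> rat) (l : rat) : 0 < l ->
  (forall x y, 0 <= x -> 0 <= y -> x + y <= l -> g (x + y) = g x + g y) ->
  forall x, 0 <= x <= l -> g x * l = x * g l.
Proof.
move=> l0 gD x /andP [x0 xl].
pose m := `|numq (x / l)|%N; pose n := `|denq (x / l)|%N.
have n0 : 0 < n%:R :> rat by rewrite ltr0n absz_gt0 denq_eq0.
have xlE : x / l = m%:R / n%:R.
  have q0 : 0 <= x / l by rewrite divr_ge0 // ltW.
  rewrite -[LHS]divq_num_den /m /n !natr_absz.
  by rewrite !ger0_norm ?denq_ge0 // ?numq_ge0.
pose t := l / n%:R.
have t0 : 0 < t by rewrite divr_gt0.
have tn : t * n%:R = l by rewrite divfK // gt_eqF.
have xt : x = t * m%:R.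
  by rewrite /t mulrAC -mulrA -xlE mulrC divfK // gt_eqF.
have gt k : (k <= n)%N -> g (t * k%:R) = g t * k%:R.
  elim: k => [|k IH] kn.
    have := gD 0 0 (lexx _) (lexx _); rewrite addr0 => /(_ (ltW l0)).
    by rewrite !mulr0; lra.
  have tk : 0 <= t * k%:R := mulr_ge0 (ltW t0) (ler0n _ _).
  have tk1 : t * k%:R + t = t * k.+1%:R by rewrite -natr1; ring.
  rewrite -tk1 gD ?(ltW t0) //; first by rewrite IH ?(ltnW kn) // -natr1; ring.
  by rewrite tk1 -tn ler_pM2l // ler_nat.
have mn : (m <= n)%N.
  by rewrite -(ler_nat rat) -(ler_pM2l t0) tn -xt.
by rewrite xt -[in RHS]tn (gt m) // -{1}tn gt //; ring.
Qed.

(* The conditions on w1 and w2 say that x1 + y1 = x2 + y2 implies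
   w1 x1 + w2 y1 = w1 x2 + w2 y2. *)
Lemma pexider_linear (w1 w2 : rat -> rat -> Prop) (a b l u : rat) : 0 < l ->
  (forall x, a <= x <= a + l -> exists2 z, a <= z <= a + l & w1 x z) ->
  (forall y, b <= y <= b + l -> exists2 z, b <= z <= b + l & w2 y z) ->
  (forall x1 x2 y1 y2 x1' x2' y1' y2',
     [/\ a <= x1 <= a + l, a <= x2 <= a + l,
         b <= y1 <= b + l & b <= y2 <= b + l] ->
     [/\ a <= x1' <= a + l, a <= x2' <= a + l,
         b <= y1' <= b + l & b <= y2' <= b + l] ->
     [/\ w1 x1 x1', w1 x2 x2', w2 y1 y1' & w2 y2 y2'] ->
     x1 + y1 = x2 + y2 -> x1' + y1' = x2' + y2') ->
  w1 a a -> w2 b b -> w1 (a + l) u -> a <= u <= a + l ->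
  forall x z, a <= x <= a + l -> a <= z <= a + l -> w1 x z ->
  (z - a) * l = (x - a) * (u - a).
Proof.
move=> l0 W1 W2 W w1a w2b w1u uI x z xI zI w1z.
have aI : a <= a <= a + l by rewrite lexx /=; lra.
have bI : b <= b <= b + l by rewrite lexx /=; lra.
(* With both [y] equal to [b], which [w2] relates to itself, the condition makes [w1]
   single-valued. *)
have uniq x' z' z'' : a <= x' <= a + l -> a <= z' <= a + l -> a <= z'' <= a + l ->
    w1 x' z' -> w1 x' z'' -> z' = z''.
  move=> x'I z'I z''I H' H''.
  by apply: (addIr b); apply: (W x' x' b b).
have /choice [f fP] : forall x, exists z, a <= x <= a + l -> a <= z <= a + l /\ w1 x z.
  move=> x'; have [/W1 [z' ? ?]|] := boolP (a <= x' <= a + l); first by exists z'.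
  by exists 0.
pose g s := f (a + s) - a.
have gD s t : 0 <= s -> 0 <= t -> s + t <= l -> g (s + t) = g s + g t.
  move=> s0 t0 stl.
  have sI : a <= a + s <= a + l by apply/andP; lra.
  have tI : a <= a + t <= a + l by apply/andP; lra.
  have stI : a <= a + (s + t) <= a + l by apply/andP; lra.
  have tbI : b <= b + t <= b + l by apply/andP; lra.
  have [[fsI fs] [ftI ft] [fstI fst_]] := And3 (fP _ sI) (fP _ tI) (fP _ stI).
  (* The increment [t] is moved from the first summand to the second, starting once from
     [a + (s + t)] and once from [a + t]; eliminating [y'] gives the additivity of [g]. *)
  have [y' y'I wy'] := W2 _ tbI.
  have E1 : f (a + (s + t)) + b = f (a + s) + y'.
    by apply: (W (a + (s + t)) (a + s) b (b + t)) => //; ring.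
  have E2 : f (a + t) + b = a + y'.
    by apply: (W (a + t) a b (b + t)) => //; ring.
  by rewrite /g; lra.
have lI : a <= a + l <= a + l by rewrite lexx andbT; lra.
have [flI fl] := fP _ lI.
have [fxI fx] := fP _ xI.
have := additive_linear l0 gD (x := x - a).
rewrite /g subrKC (uniq _ _ _ lI flI uI fl w1u) (uniq _ _ _ xI fxI zI fx w1z).
by apply; apply/andP; move/andP: xI; lra.
Qed.

End Rational.

(** * Traces on the rationals *)

Section Extension.
Variables (L : language) (d : Order.disp_t) (N : orderType d).
Variables (N0 : structure L N) (M0 : structure L rat) (j : rat -> N).
Hypothesis omin : o_minimal N0.
Hypothesis emb : elementary_embedding M0 N0 j.
Hypothesis dense : forall a b : N, a < b -> exists q, a < j q < b.

Definition all_par : N -> Prop := fun=> True.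
(** The rationals are always allowed as parameters, so that [par [::]] means definability over Q. *)
Definition par (l : seq N) : N -> Prop := fun x => (exists q, x = j q) \/ x \in l.

Lemma j_le x y : (j x <= j y) = (x <= y).
Proof.
by apply/idP/idP => H; apply (emb (Le (Var L 0) (Var L 1)) (scons x (fun=> y))).
Qed.

Lemma j_lt x y : (j x < j y) = (x < y).
Proof. by rewrite !ltNge j_le. Qed.

Lemma j_inj : injective j.
Proof. by move=> x y E; apply/eqP; rewrite eq_le -!j_le E lexx. Qed.

(** The sentence that there is no greatest element passes from the rationals to [N], where density
    then gives a rational above [a]. *)
Lemma cofinal (a : N) : exists q, a < j q.
Proof.
pose phi : formula L := Not (Ex 1 (Not (Ex 0 (Not (Le (Var L 0) (Var L 1)))))).
have : sat M0 (fun=> 0%R) phi.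
  move=> /= [y]; apply; exists (y + 1)%R; apply/negP; rewrite -ltNge.
  by rewrite ltrDl.
move=> /emb /= H; apply: contrapT => nq; apply: H; exists a => -[b /negP].
by rewrite -ltNge => /dense [q /andP [aq _]]; apply: nq; exists q.
Qed.

Lemma coinitial (a : N) : exists q, j q < a.
Proof.
pose phi : formula L := Not (Ex 1 (Not (Ex 0 (Not (Le (Var L 1) (Var L 0)))))).
have : sat M0 (fun=> 0%R) phi.
  move=> /= [y]; apply; exists (y - 1)%R; apply/negP; rewrite -ltNge.
  by rewrite gtrBl.
move=> /emb /= H; apply: contrapT => nq; apply: H; exists a => -[b /negP].
by rewrite -ltNge => /dense [q /andP [_ qa]]; apply: nq; exists q.
Qed.

(** Translation between the two notions of definability: the parameters become values of the
    variables from 1 on, and spare coordinates take the dummy value [j 0]. *)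
Lemma Def_tame A : Def1 N0 all_par A -> tame A.
Proof.
move=> [phi [s [_ H]]].
have [psi E] := sat_ren N0 phi (fun k => if s k is inl 0%N then 0 else k.+1).
apply: omin; exists psi, (fun k => inst s (fun=> j 0%R) k.-1) => x.
rewrite (H (scons (x ord0) (fun=> j 0%R))) E.
set e1 := inst _ _; set e2 := _ \o _; suff -> : e1 = e2 by [].
have env0 p : env x p 0 = x ord0.
  by rewrite /env; case: insubP => // i _ i0; congr x; apply: val_inj.
have envS p k : env x p k.+1 = p k.+1 by rewrite /env insubF.
apply: funext => k; rewrite /e1 /e2 /inst /=.
by case sk: (s k) => [[|m]|c]; rewrite ?env0 // envS /= sk.
Qed.

Lemma Def_all C P : Def N0 C P -> Def N0 all_par P.
Proof. by apply: Def_mono. Qed.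

(** This is the Tarski-Vaught property: apart from the quantified variable all values are rational,
    and elementarity applies to [Ex 0 psi]. *)
Lemma Def_rational (P : (nat -> N) -> Prop) (e : nat -> rat) :
  Def N0 (par [::]) P ->
  (exists v, P (scons v (j \o e))) -> exists q, P (scons (j q) (j \o e)).
Proof.
move=> [phi [s [sC H]]] [v Pv].
have [psi E] := sat_ren N0 phi (fun k => if s k is inl 0%N then 0 else k.+1).
have /choice [e' e'P] : forall k, exists q, forall w, s k <> inl 0%N ->
    inst s (scons w (j \o e)) k = j q.
  move=> k; rewrite /inst; case sk: (s k) => [[|m]|c].
  - by exists 0%R.
  - by exists (e m).
  - by have [[q ->]|//] := sC _ _ sk; exists q.
pose E' k := if k is k'.+1 then e' k' else 0%R.
have F w : P (scons w (j \o e)) <-> sat N0 [eta j \o E' with 0%N |-> w] psi.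
  rewrite E H; set e1 := inst _ _; set e2 := _ \o _; suff -> : e1 = e2 by [].
  apply: funext => k; rewrite /e2 /=.
  by case sk: (s k) => [[|m]|c] /=; rewrite -?(e'P k w) /e1 // /inst ?sk.
have : sat N0 (j \o E') (Ex 0 psi) by exists v; apply/F.
move=> /emb [q Hq]; exists q; apply/F.
move/emb: Hq; set e1 := _ \o _; set e2 := fun_of_simpl _.
suff -> : e1 = e2 by [].
by apply: funext => -[|k].
Qed.

Lemma scons_comp q (e : nat -> rat) : j \o scons q e = scons (j q) (j \o e).
Proof. by apply: funext => -[|k]. Qed.

Lemma cat_env_comp t (e : nat -> rat) : cat_env (map j t) (j \o e) = j \o cat_env t e.
Proof. by elim: t => //= a t ->; rewrite scons_comp. Qed.

Lemma Def_rational_cat n P (e : nat -> rat) : Def N0 (par [::]) P ->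
  (exists t, size t = n /\ P (cat_env t (j \o e))) ->
  exists t : seq rat, size t = n /\ P (cat_env (map j t) (j \o e)).
Proof.
elim: n P e => [|n IH] P e DP [t [tn Pt]].
  by exists [::]; rewrite (size0nil tn) in Pt.
case: t tn Pt => [//|v t] [tn] Pt.
have DP' := closed_scons (Def_closed N0 (par [::])) DP.
have [|t' [t'n [w Pw]]] := IH _ e DP'; first by exists t; split=> //; exists v.
have [|q Pq] := @Def_rational P (cat_env t' e) DP.
  by exists w; rewrite -cat_env_comp.
by exists (q :: t'); rewrite /= t'n cat_env_comp.
Qed.

Lemma Def_bound C P : Def N0 C P -> exists n, forall e e',
  (forall k, (k < n)%N -> e k = e' k) -> P e <-> P e'.
Proof.
move=> [phi [s [_ H]]]; have [m mP] := sat_bound N0 phi.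
have [n nP] := ord_bound (fun k : 'I_m => if s k is inl i then i.+1 else 0%N).
exists n => e e' ee'; rewrite !H; apply: mP => k km; rewrite /inst.
have := nP (Ordinal km) => /=; case: (s k) => // i; exact: ee'.
Qed.

(** A counterexample depends on finitely many coordinates, which elementarity makes rational. Laws
    definable over Q can thus be checked at rational points. *)
Lemma Def_forall_rational P : Def N0 (par [::]) P ->
  (forall e, P (j \o e)) -> forall e, P e.
Proof.
move=> DP H e; apply: contrapT => nP.
have DnP := closed_not (Def_closed N0 _) DP.
have [n nP'] := Def_bound DnP.
have [|t [_ []]] := @Def_rational_cat n _ (fun=> 0%R) DnP.
  exists (map e (iota 0 n)); rewrite size_map size_iota; split=> //.
  rewrite (nP' _ e) // => k kn; rewrite (cat_env_nth (e 0%N)) size_map size_iota kn.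
  by rewrite (nth_map 0%N) ?size_iota // nth_iota.
by rewrite cat_env_comp; apply: H.
Qed.

Lemma Def3_rational R : Def3 N0 (par [::]) R ->
  (forall a b c, R (j a) (j b) (j c)) -> forall x y z, R x y z.
Proof.
move=> DR H x y z.
have H' := @Def_forall_rational (fun e => R (e 0%N) (e 1%N) (e 2)) DR
  (fun e => H _ _ _).
exact: (H' (scons x (scons y (fun=> z)))).
Qed.

Lemma Def_generic l A p : Def1 N0 (par l) A -> A p ->
  ~ Def1 N0 (par l) (fun x => x = p) ->
  exists a b, j a < p /\ p < j b /\ forall x, j a < x < j b -> A x.
Proof.
(* The points of A that are not interior to A are finite in number, so that p
   would be definable as the only one of them in some rational interval. *)
move=> DA Ap np; apply: contrapT => nA.
pose bd x := A x /\ ~ exists a b, a < x /\ x < b /\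
  forall y, a < y /\ y < b -> A y.
have Dbd : Def1 N0 (par l) bd by rewrite /Def1 /bd; def.
have bdp : bd p.
  split=> // -[a [b [ap [pb H]]]]; apply: nA.
  have [[u /andP [au up]] [v /andP [pv vb]]] := (dense ap, dense pb).
  exists u, v; split=> //; split=> // x /andP [ux xv]; apply: H.
  by rewrite (lt_trans au) // (lt_trans xv).
have [r rP] : exists r : seq N, forall x, bd x -> x \in r.
  have tbd := @Def_tame bd (Def_all Dbd).
  apply: (tame_finite coinitial tbd) => a b ab H.
  have [q aqb] := dense ab; have [_] := H _ aqb; apply.
  have /andP [aq qb] := aqb.
  exists a, b; split=> //; split=> // y [ay yb].
  by apply: (proj1 (H y _)); rewrite ay.
have [[v0 pv0] [u0 u0p]] := (cofinal p, coinitial p).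
have [v [/andP [pv _] vr]] := avoid_right dense r pv0.
have [u [/andP [_ up] ur]] := avoid_left dense r u0p.
apply: np; apply: (Def_ext (P := fun e => bd (e 0%N) /\ j u < e 0%N /\ e 0%N < j v)).
  move=> e; split=> [[/rP er [ue ev]]|-> //].
  apply/eqP; rewrite eq_le !leNgt; apply/andP; split; apply/negP => H.
    by apply: (vr _ er); rewrite H ltW.
  by apply: (ur _ er); rewrite H ltW.
have D1 : Def1 N0 (par l) bd by [].
by def.
Qed.

Lemma Def_par_cons p l P : Def N0 (par (p :: l)) P ->
  exists2 P', Def N0 (par l) P' & forall e, P e <-> P' (scons p e).
Proof.
move=> DP; apply: Def_split; first by exists (j 0%R); left; exists 0%R.
apply: Def_mono DP => c [cj|]; first by right; left.
by rewrite inE => /orP [/eqP|]; [left|right; right].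
Qed.

(* If p is not definable from the other parameters, a rational solution of
   D'(p, q, e) persists for all parameters s in a rational interval (a, b)
   around p; a and b can in turn be eliminated by taking germs at p. *)
Lemma ex_rational_trace l D : Def N0 (par l) D ->
  exists2 D', Def N0 all_par D' & forall e : nat -> rat,
    (exists q, D (scons (j q) (j \o e))) <-> D' (j \o e).
Proof.
elim: l D => [|p l IH] D DD.
  have DD' := closed_scons (Def_closed N0 _) DD.
  exists (fun e => exists v, D (scons v e)); first exact: Def_all DD'.
  move=> e; split=> [[q Dq]|]; first by exists (j q).
  exact: Def_rational.
have [D' DD' DE] := Def_par_cons DD.
(* If [p] is definable from the other parameters, it is replaced by a quantified variable subject to
   its definition. *)
have [np|np] := pselect (Def1 N0 (par l) (fun x => x = p)).
  apply: IH; apply: (Def_ext (P := fun e => exists v, v = p /\ D' (scons v e))).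
    by move=> e; rewrite DE; split=> [[v [->]]//|Dp]; exists p.
  apply: (closed_ex (Def_closed N0 _)
    (P := fun v e => v = p /\ D' (scons v e))).
  apply: (closed_and (Def_closed N0 _)); first by exact: np.
  by apply: Def_comp DD' => -[|k]; coord.
pose D2 e := forall s, (e 1%N < s /\ s < e 2) ->
  D' (scons s (scons (e 0%N) (fun k => e k.+3))).
have DD2 : Def N0 (par l) D2.
  rewrite /D2; def.
  apply: (Def_comp (g := fun e => scons (e 0%N) (scons (e 1%N) (fun k => e k.+4))) _
    DD').
  by move=> -[|[|k]]; coord.
have {IH} [T DT TE] := IH _ DD2.
have {TE} TE a b (e : nat -> rat) : (exists q, forall s, j a < s /\ s < j b ->
    D' (scons s (scons (j q) (j \o e)))) <-> T (scons (j a) (scons (j b) (j \o e))).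
  by have := TE (scons a (scons b e)); rewrite !scons_comp.
pose U b e := exists a0, a0 < p /\ forall a, a0 < a /\ a < p ->
  T (scons a (scons b e)).
have DU (g : (nat -> N) -> nat -> N) x :
    (forall k, coordinate all_par (fun e => g e k)) -> coordinate all_par x ->
    Def N0 all_par (fun e => U (x e) (g e)).
  move=> gP xP; apply: (@Def_comp _ _ _ N0 all_par (fun e => U (e 0%N) (fun k => e k.+1))
    (fun e => scons (x e) (g e))); first by case.
  rewrite /U; def; apply: (Def_comp (g := fun e => scons (e 0%N)
    (scons (e 2) (fun k => e k.+3))) _ DT).
  by move=> -[|[|k]]; coord.
exists (fun e => exists b0, p < b0 /\ forall b, p < b /\ b < b0 -> U b e).
  by def; apply: DU; [move=> k; coord|coord].
move=> e; split=> [[q /DE Dq]|[b0 [pb0 H]]].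
  pose A s := D' (scons s (scons (j q) (j \o e))).
  have DA : Def1 N0 (par l) A.
    apply: (Def_comp (g := fun s => scons (s 0%N) (scons (j q) (j \o e))) _ DD').
    by move=> -[|[|k]]; coord.
  have [a0 [b0 [a0p [pb0 Aab]]]] := Def_generic DA Dq np.
  (* [T] is understood only at rational [a] and [b]; tameness extends the conclusion to all points
     of [N] close to [p]. *)
  have tU : tame (fun b => U b (j \o e)).
    apply: Def_tame; apply: (DU (fun=> j \o e) (fun e => e 0%N)) => [k|];
      coord.
  have [b pbb0|c pc cU] := tame_right dense cofinal tU pb0; last first.
    by exists c; split=> // b [pb bc]; apply: cU; rewrite pb.
  have tT : tame (fun a => T (scons a (scons (j b) (j \o e)))).
    apply: Def_tame.
    apply: (Def_comp (g := fun a => scons (a 0%N) (scons (j b) (j \o e))) _ DT).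
    by move=> -[|[|k]]; coord.
  have [a /andP [a0a ap]|c cp cT] := tame_left dense coinitial tT a0p; last first.
    by exists c; split=> // a [ca ap]; apply: cT; rewrite ca.
  apply/TE; exists q => s [as_ sb]; apply: Aab.
  by case/andP: pbb0 => _ /(lt_trans sb) ->; rewrite (lt_trans a0a).
have [b /andP [pb bb0]] := dense pb0.
have [|a0 [a0p Ha]] := H (j b); first by [].
have [a /andP [a0a ap]] := dense a0p.
have [|q Hq] := proj2 (TE a b e); first exact: Ha.
by exists q; apply/DE; apply: Hq.
Qed.

Definition trace (P : (nat -> rat) -> Prop) : Prop :=
  exists2 D, Def N0 all_par D & forall e, P e <-> D (j \o e).

(** The essential point is closure under projection, which is [ex_rational_trace] once the
    parameters are reduced to a finite list. *)
Lemma trace_class : def_class (fun=> True) trace.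
Proof.
have DC := Def_closed N0 all_par; split.
- move=> P [D DD H]; exists (fun e => ~ D e); first exact: (closed_not DC).
  by move=> e; rewrite H.
- move=> P P' [D DD H] [D' DD' H']; exists (fun e => D e /\ D' e).
    exact: (closed_and DC).
  by move=> e; rewrite H H'.
- move=> P [D DD H].
  have [l [_ lP]] := Def_finite (ex_intro _ (j 0%R) I) DD.
  have [|D' DD' H'] := @ex_rational_trace l D.
    by apply: lP => [|c cl]; [exists (j 0%R); left; exists 0%R|right].
  exists D' => // e; rewrite -H'.
  by split=> -[q Pq]; exists q; move: Pq; rewrite H scons_comp.
- move=> s P _ [D DD H].
  exists (fun e => D (inst (fun k => match s k with
    inl m => inl m | inr c => inr (j c) end) e)).
    exact: (closed_inst DC).
  move=> e; rewrite H; set e1 := _ \o _; set e2 := inst _ _.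
  suff -> : e1 = e2 by [].
  by apply: funext => k; rewrite /e1 /e2 /inst /=; case: (s k).
- exists (fun e => e 0%N = e 1%N); first exact: (closed_eq01 DC).
  by move=> e /=; split=> [->|/j_inj].
- exists (fun e => e 0%N <= e 1%N); first exact: (closed_le01 DC).
  by move=> e /=; rewrite j_le.
Qed.

Lemma definable_trace L' (M : structure L' rat) n (S : ('I_n -> rat) -> Prop) :
  (forall phi, trace (fun e => sat M e phi)) -> definable M S ->
  trace (fun e => S (fun i => e i)).
Proof.
move=> TM [phi [p H]].
pose g (e : nat -> rat) := env (fun i : 'I_n => e i) p.
have gP k : coordinate (fun=> True) (g^~ k).
  have [kn|nk] := ltnP k n; last first.
    by right; exists (p k) => // e; rewrite /g /env insubF // ltnNge nk.
  by left; exists k => e; rewrite /g /env insubT.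
apply: (closed_ext _ (closed_comp trace_class gP (TM phi))) => e.
by rewrite H.
Qed.

Lemma reduct_trace L1 L2 (M1 : structure L1 rat) (M2 : structure L2 rat) :
  reduct M1 M2 -> (forall phi, trace (fun e => sat M2 e phi)) ->
  forall phi, trace (fun e => sat M1 e phi).
Proof.
move=> [RF RR] TM; apply: (closed_sat trace_class) => n f.
  apply: (closed_ext _ (definable_trace TM (RF n f))) => e.
  by rewrite /graph /=.
exact: definable_trace TM (RR n f).
Qed.

(** Only symbols need checking: those of [L] are handled by elementarity, and the added predicates
    are traces by construction. *)
Lemma induced_trace phi : trace (fun e => sat (induced M0 N0 j) e phi).
Proof.
have T0 phi0 : trace (fun e => sat M0 e phi0).
  exists (fun e => sat N0 e phi0); last by move=> e; apply: emb.
  by exists phi0, inl; split.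
apply: (closed_sat trace_class) => n.
  move=> f; exact: (T0 (@Eq L (@App L n f (fun i => Var L i)) (Var L n))).
case=> [r|[D [psi [p H]]]]; first exact: (T0 (Atom r (fun i : 'I_n => Var L i))).
exists (fun e => D (fun i => e i)) => //.
exists psi, (fun k => if (k < n)%N then inl k else inr (p k)); split=> // e.
rewrite H; set e1 := env _ _; set e2 := inst _ _; suff -> : e1 = e2 by [].
apply: funext => k; rewrite /e1 /e2 /env /inst.
by case: ltnP => kn; [rewrite insubT|rewrite insubF // ltnNge kn].
Qed.

(* Otherwise each {y | R y c} is finite, so that the suprema of the sets
   {c | R y c} form an infinite set, hence contain an interval ]c0, c1[; but
   those above c0 come from finitely many y. *)
Lemma uniform_interval (R : N -> N -> Prop) a y0 y1 :
  Def2 N0 all_par R -> y0 < y1 ->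
  (forall y c c', R y c -> a < c' -> c' < c -> R y c') ->
  (forall q, y0 < j q < y1 -> exists c, a < c /\ R (j q) c) ->
  exists c u v, [/\ a < j c, y0 < j u, j u < j v, j v < y1 &
    forall y, j u < y < j v -> R y (j c)].
Proof.
move=> DR y01 Rdown Rex; apply: contrapT => nU.
have fin c : a < c ->
    exists r : seq N, forall y, (y0 < y /\ y < y1 /\ R y c) -> y \in r.
  move=> ac; apply: (tame_finite coinitial).
    by apply: Def_tame; rewrite /Def1; def.
  move=> u v uv H; have [u' /andP [uu' u'v]] := dense uv.
  have [v' /andP [u'v' v'v]] := dense u'v.
  have [c' /andP [ac' c'c]] := dense ac.
  apply: nU; exists c', u', v'; split=> //.
  - by have [|] := H (j u'); rewrite ?uu'.
  - by have [|_ []] := H (j v'); rewrite ?v'v ?(lt_trans uu').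
  - move=> y /andP [u'y yv']; apply: Rdown c'c => //.
    have [|_ [_ Ryc]] := H y; last exact: Ryc.
    by rewrite (lt_trans uu') // (lt_trans yv').
(* For [a < c], this says that [c] separates the values above [a] that satisfy [R y] from those that
   do not, leaving open what happens at [c] itself. *)
pose supR y c := forall c', a < c' -> (c' < c -> R y c') /\ (c < c' -> ~ R y c').
pose E c := a < c /\ exists y, y0 < y /\ y < y1 /\ supR y c.
have tE : tame E by apply: Def_tame; rewrite /Def1 /E /supR; def.
have supRU y c c' : a < c -> a < c' -> supR y c -> supR y c' -> c = c'.
  move=> ac ac' Hc Hc'; apply/eqP; rewrite eq_le !leNgt; apply/andP.
  split; apply/negP => /dense [q /andP [H1 H2]].
    by case: (proj2 (Hc' (j q) (lt_trans ac' H1)) H1);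
      apply: (proj1 (Hc (j q) (lt_trans ac' H1)) H2).
  by case: (proj2 (Hc (j q) (lt_trans ac H1)) H1);
    apply: (proj1 (Hc' (j q) (lt_trans ac H1)) H2).
have [[c0 [c1 [c01 EI]]]|nE] := pselect (exists c0 c1, c0 < c1 /\
    forall c, c0 < c < c1 -> E c).
  have [q c0qc1] := dense c01; have [aq _] := EI _ c0qc1.
  have /andP [c0q qc1] := c0qc1.
  have [r rP] := fin _ aq.
  have /choice [g gP] : forall y, exists c, forall c', a < c' -> supR y c' ->
      supR y c /\ a < c.
    move=> y; have [[c [ac Hc]]|nc] := pselect (exists c, a < c /\ supR y c).
      by exists c.
    by exists a => c' ac' Hc'; case: nc; exists c'.
  have [q' [/andP [qq' q'c1] avoid]] := avoid_right dense (map g r) qc1.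
  have [|aq' [y [y0y [yy1 Hy]]]] := EI (j q'); first by rewrite q'c1 (lt_trans c0q).
  apply: (avoid (j q')); last by rewrite qq' lexx.
  have yr : y \in r by apply: rP; split=> //; split=> //; apply: (proj1 (Hy _ aq)).
  have [Hg ag] := gP y _ aq' Hy.
  by rewrite (supRU y _ _ aq' ag Hy Hg) map_f.
have [rE rEP] : exists r : seq N, forall x, E x -> x \in r.
  by apply: (tame_finite coinitial tE) => c0 c1 c01 H; apply: nE; exists c0, c1.
(* When [E] is finite, some [c] lies below all its points, and some rational [y] does not satisfy
   [R y c]. The supremum attached to this [y] is then a point of [E] not above [c]. *)
have [a1 aa1] := cofinal a.
have [c [/andP [ac _] cE]] := avoid_right dense rE aa1.
have [r rP] := fin _ ac.
have [y [/andP [y0y yy1] yr]] := avoid_right dense r y01.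
have nRy : ~ R (j y) (j c).
  by move=> Ryc; apply: (yr (j y)); rewrite ?y0y ?lexx //; apply: rP.
have [|c' [ac' Rc']] := Rex y; first by rewrite y0y.
have tA : tame (fun c => a < c /\ R (j y) c).
  by apply: Def_tame; rewrite /Def1; def.
have [|x [ax Rx]|z [z1 z2]] := tame_sup dense cofinal (x0 := c') (b := j c) tA.
- by [].
- by rewrite leNgt; apply/negP => cx; apply: nRy; apply: Rdown Rx ac cx.
have az : a < z by exact: lt_le_trans ac' (z1 _ (conj ac' Rc')).
apply: (cE z).
  apply: rEP; split=> //; exists (j y); split=> //; split=> // x ax.
  split=> [/z2 [x' [[ax' Rx'] xx']]|zx Rx]; first exact: Rdown Rx' ax xx'.
  by have := z1 x (conj ax Rx); rewrite leNgt zx.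
rewrite az leNgt; apply/negP => /z2 [x [[ax Rx] cx]]; apply: nRy.
exact: Rdown Rx ac cx.
Qed.

(** Four uses of [uniform_interval]. Along [x], it shows that for fixed rational [y] all but
    finitely many [x] are [good]. Along [y], it makes uniform in turn the length of a stretch of
    good points after [x0], the bound [c3] at one such point [x2], and the length of the stretch
    after [x2] on which [c3] works. *)
Lemma uniform_box (R : N -> N -> N -> Prop) p x0 x1 y0 y1 :
  Def3 N0 all_par R -> x0 < x1 -> y0 < y1 ->
  (forall x y c c', R x y c -> p < c' -> c' < c -> R x y c') ->
  (forall x y, x0 < j x < x1 -> y0 < j y < y1 ->
     exists c, p < c /\ R (j x) (j y) c) ->
  exists c u v u' v', [/\ p < j c, [/\ x0 < j u, j u < j v & j v < x1],
    [/\ y0 < j u', j u' < j v' & j v' < y1] &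
    forall x y, j u < x < j v -> j u' < y < j v' -> R x y (j c)].
Proof.
move=> DR x01 y01 Rdown Rex.
pose good x y := exists c, p < c /\ exists x', x < x' /\
  forall u, x < u /\ u < x' -> R u y c.
have Dgood : Def2 N0 all_par good by rewrite /Def2 /good; def.
have fin y : y0 < j y < y1 -> exists r : seq N, forall x,
    (x0 < x /\ x < x1 /\ ~ good x (j y)) -> x \in r.
  move=> y01y; apply: (tame_finite coinitial).
    by apply: Def_tame; rewrite /Def1; def.
  move=> a b ab H.
  have [|||c [u [v [pc au uv vb Rc]]]] :=
    uniform_interval (R := fun x c => R x (j y) c) (a := p) _ ab.
  - by rewrite /Def2; def.
  - by move=> x c c'; apply: Rdown.
  - by move=> q /H [x0q [qx1 _]]; apply: Rex; rewrite // x0q.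
  have [x /andP [ux xv]] := dense uv.
  have [|_ [_ []]] := H (j x); first by rewrite (lt_trans au) // (lt_trans xv).
  exists (j c); split=> //; exists (j v); split=> // w [xw wv]; apply: Rc.
  by rewrite wv (lt_trans ux).
have [|||c1 [u1 [v1 [xc1 yu1 uv1 vy1 R1]]]] := uniform_interval (a := x0)
    (R := fun y c => forall x, x0 < x /\ x < c /\ x < x1 -> good x y) _ y01.
- by rewrite /Def2; def.
- by move=> y c c' H _ c'c x [x0x [xc' xx1]]; apply: H; rewrite (lt_trans xc').
- move=> y /fin [r rP]; have [q [/andP [x0q qx1] qr]] := avoid_right dense r x01.
  exists (j q); split=> // x [x0x [xq xx1]]; apply: contrapT => ng.
  by apply: (qr x); [apply: rP|rewrite x0x ltW].
have [|x2 /andP [x02]] := @dense x0 (Order.min (j c1) x1).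
  by rewrite lt_min xc1.
rewrite lt_min => /andP [x2c1 x21].
have [|||c3 [u3 [v3 [pc3 u13 uv3 v31 R3]]]] := uniform_interval (a := p)
    (R := fun y c => exists x', j x2 < x' /\ forall u, j x2 < u /\ u < x' -> R u y c)
    _ uv1.
- by rewrite /Def2; def.
- move=> y c c' [x' [x2x' H]] pc' c'c; exists x'; split=> // u /H Rc.
  exact: Rdown Rc pc' c'c.
- move=> y /R1 H; apply: H => //.
have [|||c4 [u4 [v4 [x24 u34 uv4 v43 R4]]]] := uniform_interval (a := j x2)
    (R := fun y c => forall u, j x2 < u /\ u < c -> R u y (j c3)) _ uv3.
- by rewrite /Def2; def.
- by move=> y c c' H _ c'c u [x2u uc']; apply: H; rewrite (lt_trans uc').
- by move=> y /R3.
have [|x5 /andP [x25]] := @dense (j x2) (Order.min (j c4) x1).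
  by rewrite lt_min x24.
rewrite lt_min => /andP [x54 x51].
exists c3, x2, x5, u4, v4; split=> [//|||x y /andP [x2x xx5] /R4].
- by split.
- by split; rewrite // ?(lt_trans yu1) ?(lt_trans v43) // (lt_trans u13, lt_trans v31).
- by apply; split=> //; apply: lt_trans x54.
Qed.

(* The values f x y do not change when a parameter p that is not definable from
   the others is moved slightly; by [uniform_box], it can be replaced by a fixed
   rational on a smaller box. *)
Lemma Def_rational_box l (D : N -> N -> N -> Prop) (f : rat -> rat -> rat)
    (u v u' v' : rat) :
  Def3 N0 (par l) D -> (forall x y z z', D x y z -> D x y z' -> z = z') ->
  u < v -> u' < v' ->
  (forall x y, u < x < v -> u' < y < v' -> D (j x) (j y) (j (f x y))) ->
  exists D0 u0 v0 u0' v0', [/\ Def3 N0 (par [::]) D0,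
    (forall x y z z', D0 x y z -> D0 x y z' -> z = z'), u0 < v0, u0' < v0' &
    forall x y, u0 < x < v0 -> u0' < y < v0' -> D0 (j x) (j y) (j (f x y))].
Proof.
elim: l D u v u' v' => [|p l IH] D u v u' v' DD Dfun uv uv' Df.
  by exists D, u, v, u', v'.
have [D1 DD1 D1E] := Def_par_cons DD.
pose e0 x y z : nat -> N := scons x (scons y (scons z (fun=> j 0%R))).
have [np|np] := pselect (Def1 N0 (par l) (fun x => x = p)).
  apply: IH Df => //; rewrite /Def3.
  apply: (Def_ext (P := fun e => exists s, s = p /\ D1 (scons s e))).
    by move=> e; rewrite D1E; split=> [[s [->]]//|Dp]; exists p.
  apply: (closed_ex (Def_closed N0 _) (P := fun s e => s = p /\ D1 (scons s e))).
  apply: (closed_and (Def_closed N0 _)); first by exact: np.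
  by apply: Def_comp DD1 => -[|k]; coord.
pose D1' s x y z := D1 (scons s (e0 x y z)).
have DD1' : Def4 N0 (par l) D1'.
  apply: (Def_comp _ DD1) => -[|[|[|[|k]]]]; coord.
(* Away from [s = p] the relation [D1'] may fail to be functional; [D2] keeps only the values that
   are unique. *)
pose D2 s x y z := D1' s x y z /\ forall z', D1' s x y z' -> z' = z.
have DD2 : Def4 N0 (par l) D2 by rewrite /Def4 /D2; def.
have D2p x y z : D x y z -> D2 p x y z.
  move=> /[dup] Dxyz /(D1E (e0 x y z)); split=> // z' /(D1E (e0 x y z')) H.
  exact: Dfun H Dxyz.
(* The range of [s] includes [p], which forces the common value [z] to be [j (f x y)] at rational
   points. *)
pose R x y c := exists z, forall s, (p <= s /\ s < c) -> D2 s x y z.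
have DR : Def3 N0 all_par R.
  have DD3 : Def4 N0 all_par D2 := Def_mono (fun _ _ => I) DD2.
  by rewrite /Def3 /R; def.
have [||x y c c' [z Hz] pc' c'c|x y|c [x0 [x1 [y0 [y1 [pc Hx Hy HR]]]]]] :=
  @uniform_box R p (j u) (j v) (j u') (j v') DR.
- by rewrite j_lt.
- by rewrite j_lt.
- by exists z => s [ps sc]; apply: Hz; rewrite (lt_trans sc).
- rewrite !j_lt => ux uy.
  have DA : Def1 N0 (par l) (fun s => D2 s (j x) (j y) (j (f x y))).
    by rewrite /Def1; def.
  have [|a [b [ap [pb Hab]]]] := Def_generic DA _ np.
    by apply: D2p; apply: Df.
  exists (j b); split=> //; exists (j (f x y)) => s [ps sb]; apply: Hab.
  by rewrite (lt_le_trans ap).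
rewrite !j_lt in Hx Hy.
have [s /andP [ps sc]] := dense pc.
case: Hx => ux0 x01 x1v; case: Hy => uy0 y01 y1v.
apply: (IH (D2 (j s))  x0 x1 y0 y1) => //.
- by rewrite /Def3; def.
- by move=> x y z z' [H _] [_ H']; apply: H'.
- move=> x y /andP [x0x xx1] /andP [y0y yy1].
  have [||z Hz] := HR (j x) (j y); rewrite ?j_lt ?x0x ?y0y //.
  suff -> : j (f x y) = z by apply: Hz; rewrite ltW.
  have [_ H] := Hz p (conj (lexx p) pc).
  apply: H; apply: (proj1 (D2p _ _ _ _)); apply: Df.
    by rewrite (lt_trans ux0) // (lt_trans xx1).
  by rewrite (lt_trans uy0) // (lt_trans yy1).
Qed.

(** * Addition and multiplication by 1/pi *)

Section Real.

Variable R : realType.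

(** The real number of the cut that [y] makes in the rationals; by density this is an order
    embedding of [N] which extends [ratr]. *)
Definition to_real (y : N) : R :=
  sup [set x | exists2 q, j q < y & x = ratr q]%classic.

Lemma lt_to_real q y : (ratr q < to_real y)%R = (j q < y).
Proof.
have ne : ([set x | exists2 q, j q < y & x = ratr q :> R] !=set0)%classic.
  by have [q0 q0y] := coinitial y; exists (ratr q0), q0.
have [q1 yq1] := cofinal y.
have ub : has_ubound [set x | exists2 q, j q < y & x = ratr q :> R]%classic.
  exists (ratr q1) => _ [q' q'y ->]; rewrite ler_rat ltW // -j_lt.
  exact: lt_trans yq1.
apply/idP/idP => [/(sup_gt ne) [_ [q' q'y ->]]|].
  by rewrite ltr_rat -j_lt => /lt_trans; apply.
move=> /dense [q' /andP [qq' q'y]].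
apply: (@lt_le_trans _ _ (ratr q')); first by rewrite ltr_rat -j_lt.
by apply: ub_le_sup => //; exists q'.
Qed.

Lemma to_real_j q : to_real (j q) = ratr q.
Proof.
apply/eqP; rewrite eq_le !leNgt; apply/andP; split; apply/negP.
  move=> /rat_in_itvoo [x]; rewrite in_itv /= => /andP [].
  by rewrite ltr_rat lt_to_real j_lt => /lt_trans H /H; rewrite ltxx.
move=> /rat_in_itvoo [x]; rewrite in_itv /= => /andP [+].
rewrite ltr_rat => + xq; rewrite ltNge.
by move=> /negP; apply; apply: ltW; rewrite lt_to_real j_lt.
Qed.

Lemma to_real_lt x y : (to_real x < to_real y)%R = (x < y).
Proof.
have H a b : a < b -> (to_real a < to_real b)%R.
  move=> /dense [q /andP [aq qb]].
  have [q' /andP [aq' q'q]] := dense aq.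
  apply: (@le_lt_trans _ _ (ratr q)); last by rewrite lt_to_real.
  by rewrite leNgt lt_to_real -leNgt ltW.
apply/idP/idP; last exact: H.
by apply: contraTT; rewrite -!leNgt le_eqVlt => /orP [/eqP -> //|/H /ltW].
Qed.

Lemma to_real_inj : injective to_real.
Proof.
by move=> x y E; apply/eqP; rewrite eq_le !leNgt -!to_real_lt E ltxx.
Qed.

Lemma gt_to_real q y : (to_real y < ratr q)%R = (y < j q).
Proof. by rewrite -to_real_j to_real_lt. Qed.

Lemma le_to_real q y : (ratr q <= to_real y)%R = (j q <= y).
Proof. by rewrite !leNgt gt_to_real. Qed.

Lemma ge_to_real q y : (to_real y <= ratr q)%R = (y <= j q).
Proof. by rewrite !leNgt lt_to_real. Qed.

Lemma ratr_between (x y : R) : (x < y)%R -> exists q, (x < ratr q)%R /\ (ratr q < y)%R.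
Proof. by move=> /rat_in_itvoo [q]; rewrite in_itv /= => /andP []; exists q. Qed.

(** [A] is known at rational points only. These determine its right germs, which are thereby known
    at every [w]. *)
Lemma cut_right A (r : R) : Def1 N0 all_par A ->
  (forall q, A (j q) <-> (ratr q < r)%R) -> forall w,
  (exists b, w < b /\ forall z, w < z /\ z < b -> A z) <-> (to_real w < r)%R.
Proof.
move=> DA Ar w; split=> [[b [/dense [q /andP [wq qb]] H]]|].
  by apply: (@lt_trans _ _ (ratr q)); [rewrite gt_to_real|apply/Ar/H].
move=> /ratr_between [q []]; rewrite gt_to_real => wq qr.
have [x /andP [wx xq]|b wb H] := tame_right dense cofinal (Def_tame DA) wq.
  by apply/Ar; apply: lt_trans qr; rewrite ltr_rat -j_lt.
by exists b; split=> // z [wz zb]; apply: H; rewrite wz.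
Qed.

Lemma cut_left A (r : R) : Def1 N0 all_par A ->
  (forall q, A (j q) <-> (r < ratr q)%R) -> forall w,
  (exists b, b < w /\ forall z, b < z /\ z < w -> A z) <-> (r < to_real w)%R.
Proof.
move=> DA Ar w; split=> [[b [/dense [q /andP [bq qw]] H]]|].
  by apply: (@lt_trans _ _ (ratr q)); [apply/Ar/H|rewrite lt_to_real].
move=> /ratr_between [q [rq]]; rewrite lt_to_real => qw.
have [x /andP [qx xw]|b bw H] := tame_left dense coinitial (Def_tame DA) qw.
  by apply/Ar; apply: lt_trans rq _; rewrite ltr_rat -j_lt.
by exists b; split=> // z [bz zw]; apply: H; rewrite bz.
Qed.

Lemma is_sup_cut A (r : R) z : (forall w, A w <-> (to_real w < r)%R) ->
  is_sup A z <-> to_real z = r.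
Proof.
move=> Ar; split=> [[z1 z2]|zr].
  apply/eqP; rewrite eq_le !leNgt; apply/andP; split; apply/negP.
    move=> /ratr_between [q []]; rewrite lt_to_real => rq /z2 [x [/Ar xr qx]].
    by have := lt_trans xr rq; rewrite gt_to_real => /(lt_trans qx); rewrite ltxx.
  move=> /ratr_between [q []]; rewrite gt_to_real => zq qr.
  have : j q <= z by apply/z1/Ar; rewrite to_real_j.
  by rewrite leNgt zq.
split=> [x /Ar|w]; first by rewrite -zr to_real_lt => /ltW.
by move=> /dense [q /andP [wq qz]]; exists (j q); split=> //; rewrite Ar -zr to_real_lt.
Qed.

(** [R] may have cuts that [N] does not fill, but o-minimality fills the definable ones. *)
Lemma cut_exists A (r : R) : Def1 N0 all_par A ->
  (forall w, A w <-> (to_real w < r)%R) -> exists z, to_real z = r.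
Proof.
move=> DA Ar.
have [q [_ qr]] : exists q, (r - 1 < ratr q)%R /\ (ratr q < r)%R.
  by apply: ratr_between; lra.
have [q' [rq' _]] : exists q, (r < ratr q)%R /\ (ratr q < r + 1)%R.
  by apply: ratr_between; lra.
have [|x /Ar xr|z] := tame_sup dense cofinal (x0 := j q) (b := j q') (Def_tame DA).
- by apply/Ar; rewrite to_real_j.
- by rewrite ltW // -to_real_lt to_real_j (lt_trans xr).
by move=> /(is_sup_cut _ Ar); exists z.
Qed.

Lemma trace3 P : trace P -> exists2 D, Def3 N0 all_par D &
  forall a b c, D (j a) (j b) (j c) <-> P (scons a (scons b (scons c (fun=> 0%R)))).
Proof.
move=> [D DD DP].
exists (fun x y z => D (scons x (scons y (scons z (fun=> j 0%R))))).
  by apply: (Def_comp _ DD) => -[|[|[|k]]]; coord.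
move=> a b c; rewrite DP !scons_comp; set e1 := fun=> _; set e2 := _ \o _.
by have -> : e1 = e2 by [].
Qed.

Hypothesis Qvs_trace : forall phi, trace (fun e => sat (Qvs_pi R) e phi).

(** The trace of [z < x + y] is uncontrolled off the rationals. Taking right germs and then a
    supremum makes it functional on all of [N], with the correct value at rational arguments. *)
Lemma sum_trace : exists2 D, Def3 N0 all_par D & (forall x y z z',
  D x y z -> D x y z' -> z = z') /\ forall x y, D (j x) (j y) (j (x + y)%R).
Proof.
pose phi : formula Qvs_pi_language :=
  Not (Le (@App Qvs_pi_language 2 Qplus (fun i => Var _ i)) (Var _ 2)).
have [D DD DE] := trace3 (Qvs_trace phi).
have {} DE a b c : D (j a) (j b) (j c) <-> (c < a + b)%R.
  by rewrite DE /= ltNge; split=> /negP.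
pose D1 x y z := exists b, z < b /\ forall w, z < w /\ w < b -> D x y w.
have DD1 : Def3 N0 all_par D1 by rewrite /Def3 /D1; def.
exists (fun x y z => is_sup (D1 x y) z).
  by rewrite /Def3 /is_sup; def.
split=> [x y z z'|x y]; first exact: is_sup_unique.
rewrite (is_sup_cut (r := ratr (x + y))) ?to_real_j //.
apply: cut_right => [|q]; first by rewrite /Def1; def.
by rewrite DE ltr_rat.
Qed.

(** [V (j c)] is the dilation of ratio [1 / pi] centred at [c]. The inequality between rationals is
    extended to all [x] by left germs, then to all [y] by right germs. *)
Lemma dilation_trace : exists2 V, Def3 N0 all_par V &
  (forall c x, exists z, V (j c) x z) /\ forall c x z, V (j c) x z <-> to_real z = (ratr c + (to_real x - ratr c) / pi)%R.
Proof.
have pi0 := pi_gt0 R.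
pose Plus s t : term Qvs_pi_language :=
  @App Qvs_pi_language 2 Qplus (fun i => if i == ord0 then s else t).
(* Variables 3 and 4 stand for the differences [y - c] and [x - c]. *)
pose phi : formula Qvs_pi_language :=
  Ex 3 (Ex 4 (And (Eq (Plus (Var _ 3) (Var _ 0)) (Var _ 2))
    (And (Eq (Plus (Var _ 4) (Var _ 0)) (Var _ 1))
      (@Atom Qvs_pi_language 2 Qpi (fun i => Var _ (3 + i)))))).
have [H DH HE] := trace3 (Qvs_trace phi).
have {} HE c x y : H (j c) (j x) (j y) <-> ((pi : R) * (ratr y - ratr c) < ratr x - ratr c)%R.
  rewrite HE /= -!rmorphB; split=> [[u [v [<- [<- uv]]]]|xy].
    by rewrite !addrK.
  by exists (y - c)%R, (x - c)%R; rewrite !subrK.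
pose H1 c x y := exists b, b < x /\ forall w, b < w /\ w < x -> H c w y.
have DH1 : Def3 N0 all_par H1 by rewrite /Def3 /H1; def.
pose H2 c x y := exists b, y < b /\ forall w, y < w /\ w < b -> H1 c x w.
have DH2 : Def3 N0 all_par H2 by rewrite /Def3 /H2; def.
have H1E c x y : H1 (j c) x (j y) <->
    ((pi : R) * (ratr y - ratr c) + ratr c < to_real x)%R.
  apply: cut_left => [|q]; first by rewrite /Def1; def.
  by rewrite HE; split; lra.
have H2E c x y : H2 (j c) x y <->
    (to_real y < ratr c + (to_real x - ratr c) / pi)%R.
  apply: cut_right => [|q]; first by rewrite /Def1; def.
  by rewrite H1E -ltrBlDl ltr_pdivlMr // mulrC; split; lra.
exists (fun c x z => is_sup (H2 c x) z).
  by rewrite /Def3 /is_sup; def.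
split=> c x; last by move=> z; apply: is_sup_cut.
have [|z zE] := @cut_exists (H2 (j c) x) _ _ (H2E c x).
  by rewrite /Def1; def.
by exists z; rewrite (is_sup_cut _ (H2E c x)).
Qed.

Local Notation Q := (par [::]).

Lemma Def1_rational A : Def1 N0 Q A -> (exists v, A v) -> exists q, A (j q).
Proof.
by move=> DA; apply: (@Def_rational (fun e => A (e 0%N)) (fun=> 0%R) DA).
Qed.

Lemma Def_par_cat l P : Def N0 (par l) P ->
  exists2 P', Def N0 Q P' & forall e, P e <-> P' (cat_env l e).
Proof.
elim: l P => [|p l IH] P DP; first by exists P.
have [P1 DP1 P1E] := Def_par_cons DP.
have [P' DP' P'E] := IH _ DP1.
(* [P'] expects [p] after the values of [l], and [g] moves it there from the front. *)
pose g (e : nat -> N) k :=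
  if (k < size l)%N then e k.+1 else if k == size l then e 0%N else e k.
exists (fun e => P' (g e)).
  by apply: (Def_comp (g := g) _ DP') => k; rewrite /g;
    case: (k < size l)%N; [|case: (k == size l)]; coord.
move=> e; rewrite P1E P'E.
suff -> : cat_env l (scons p e) = g (cat_env (p :: l) e) by [].
apply: funext => k; rewrite /g /= (cat_env_nth p).
case: ltnP => kl; first by rewrite (cat_env_nth p) kl.
case: eqP => [->|kl']; first by rewrite subnn.
have {kl kl'} kl : (size l < k)%N by rewrite ltn_neqAle kl andbT eq_sym; apply/eqP.
rewrite -(subnKC kl) addSn -addnS addKn /= addnS /=.
by rewrite (cat_env_nth p) ltnNge leq_addr /= addKn.
Qed.

(** Comparisons with rational bounds are laws definable over Q, so they pass from rational points to
    the whole box, where they determine the real value of [z]. *)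
Lemma sum_real (D : N -> N -> N -> Prop) (u v u' v' : rat) : Def3 N0 Q D ->
  (forall x y z z', D x y z -> D x y z' -> z = z') ->
  (forall x y, (u < x < v)%R -> (u' < y < v')%R -> D (j x) (j y) (j (x + y)%R)) ->
  forall x y, j u < x < j v -> j u' < y < j v' ->
    (exists z, D x y z) /\
    (forall z, D x y z <-> to_real z = (to_real x + to_real y)%R).
Proof.
move=> DD Dfun Dsum.
have ex x y : j u < x < j v -> j u' < y < j v' -> exists z, D x y z.
  move=> /andP [ux xv] /andP [uy yv].
  pose S (x y z : N) := (j u < x /\ x < j v) -> (j u' < y /\ y < j v') ->
    exists z, D x y z.
  have DS : Def3 N0 Q S by rewrite /Def3 /S; def.
  have HS := Def3_rational DS; apply: (HS _ x y x) => // a b c.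
  rewrite /S !j_lt => -[ua av] [ub bv].
  by exists (j (a + b)%R); apply: Dsum; rewrite ?ua ?ub.
have lo q r x y z : j u < x < j v -> j u' < y < j v' -> D x y z ->
    j q < x -> j r < y -> j (q + r)%R < z.
  move=> /andP [ux xv] /andP [uy yv] Dz qx ry.
  pose S (x y z : N) := (j u < x /\ x < j v) /\ (j u' < y /\ y < j v') ->
    D x y z -> (j q < x /\ j r < y) -> j (q + r)%R < z.
  have DS : Def3 N0 Q S by rewrite /Def3 /S; def.
  have HS := Def3_rational DS; apply: (HS _ x y z) => // a b c.
  rewrite /S !j_lt => -[[ua av] [ub bv]] Dc [qa rb].
  have /j_inj -> : j c = j (a + b)%R.
    by apply: Dfun Dc _; apply: Dsum; rewrite ?ua ?ub.
  by rewrite ltrD.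
have hi q r x y z : j u < x < j v -> j u' < y < j v' -> D x y z ->
    x < j q -> y < j r -> z < j (q + r)%R.
  move=> /andP [ux xv] /andP [uy yv] Dz xq yr.
  pose S (x y z : N) := (j u < x /\ x < j v) /\ (j u' < y /\ y < j v') ->
    D x y z -> (x < j q /\ y < j r) -> z < j (q + r)%R.
  have DS : Def3 N0 Q S by rewrite /Def3 /S; def.
  have HS := Def3_rational DS; apply: (HS _ x y z) => // a b c.
  rewrite /S !j_lt => -[[ua av] [ub bv]] Dc [aq br].
  have /j_inj -> : j c = j (a + b)%R.
    by apply: Dfun Dc _; apply: Dsum; rewrite ?ua ?ub.
  by rewrite ltrD.
have real x y z : j u < x < j v -> j u' < y < j v' -> D x y z ->
    to_real z = (to_real x + to_real y)%R.
  move=> xI yI Dz; apply/eqP; rewrite eq_le !leNgt; apply/andP; split; apply/negP.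
    move=> H.
    have [q [xq qz]] : exists q, (to_real x < ratr q)%R /\ (ratr q < to_real z - to_real y)%R.
      by apply: ratr_between; lra.
    have [r [yr rz]] : exists r, (to_real y < ratr r)%R /\ (ratr r < to_real z - ratr q)%R.
      by apply: ratr_between; lra.
    rewrite gt_to_real in xq; rewrite gt_to_real in yr.
    have := hi _ _ _ _ _ xI yI Dz xq yr; rewrite -gt_to_real rmorphD /=; lra.
  move=> H.
  have [q [qz qx]] : exists q, (to_real z - to_real y < ratr q)%R /\ (ratr q < to_real x)%R.
    by apply: ratr_between; lra.
  have [r [rz ry]] : exists r, (to_real z - ratr q < ratr r)%R /\ (ratr r < to_real y)%R.
    by apply: ratr_between; lra.
  rewrite lt_to_real in qx; rewrite lt_to_real in ry.
  have := lo _ _ _ _ _ xI yI Dz qx ry; rewrite -lt_to_real rmorphD /=; lra.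
move=> x y xI yI; split; first exact: ex.
move=> z; split=> [|zE]; first exact: real.
have [z' Dz'] := ex x y xI yI.
by rewrite (to_real_inj (etrans zE (esym (real _ _ _ xI yI Dz')))).
Qed.

(** * Families of additive maps with variable slope *)

Section Contradiction.
Variables (D V : N -> N -> N -> Prop) (u v u' v' : rat).
Hypothesis DD : Def3 N0 Q D.
Hypothesis Dfun : forall x y z z', D x y z -> D x y z' -> z = z'.
Hypothesis uv : (u < v)%R.
Hypothesis uv' : (u' < v')%R.
Hypothesis Dsum : forall x y, (u < x < v)%R -> (u' < y < v')%R ->
  D (j x) (j y) (j (x + y)%R).
Hypothesis DV : Def3 N0 all_par V.
Hypothesis Vex : forall c x, exists z, V (j c) x z.
Hypothesis VE : forall c x z,
  V (j c) x z <-> to_real z = (ratr c + (to_real x - ratr c) / pi)%R.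

Let a : rat := ((u + v) / 2)%R.
Let b : rat := ((u' + v') / 2)%R.
(** A quarter of the shorter side keeps [[a, a + l]] and [[b, b + l]], which start at midpoints,
    strictly inside the box. *)
Let l : rat := (Num.min (v - u) (v' - u') / 4)%R.

Let bounds : [/\ (0 < l)%R, (u < a)%R, (a + l < v)%R, (u' < b)%R & (b + l < v')%R].
Proof.
have [l0 lv lv'] : [/\ (0 < l)%R, (l * 4 <= v - u)%R & (l * 4 <= v' - u')%R].
  rewrite /l divfK // !ge_min !lexx orbT; split=> //.
  by apply: divr_gt0 => //; rewrite lt_min !subr_gt0 uv.
by move: uv uv'; rewrite /a /b; split=> //; lra.
Qed.

Section Family.
Variables (n : nat) (V' : (nat -> N) -> Prop).
Hypothesis DV' : Def N0 Q V'.

(* The first n values of E are the parameters of a member of the family, and in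
   [additive_member] the value E n is the image of a + l, which encodes the slope. *)
Definition member (c : rat) (E : nat -> N) (x z : N) : Prop :=
  V' (fun k => if (k < n)%N then E k else scons (j c) (scons x (fun=> z)) (k - n)).

Lemma Def_member C c (g : (nat -> N) -> nat -> N) x z :
  (forall q, C (j q)) ->
  (forall k, coordinate C (fun e => g e k)) -> coordinate C x -> coordinate C z ->
  Def N0 C (fun e => member c (g e) (x e) (z e)).
Proof.
move=> Cj gP xP zP.
have DC : Def N0 C V' by apply: Def_mono DV' => x' [[q ->]|].
apply: (Def_comp (g := fun e k => if (k < n)%N then g e k else
  scons (j c) (scons (x e) (fun=> z e)) (k - n)) _ DC) => k.
case: (k < n)%N => //; case: (k - n)%N => [|[|m]] //=.
by apply: coordinate_cst.
Qed.

(** The hypotheses of [pexider_linear], expressed over Q: equality of two sums becomes a common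
    value [z] of [D]. Two intervals occur because [D] is addition on a box whose sides may be
    disjoint. *)
Definition additive_member (E : nat -> N) : Prop :=
  (forall x, (j a <= x /\ x <= j (a + l)%R) ->
     exists x', (j a <= x' /\ x' <= j (a + l)%R) /\ member a E x x') /\
  (forall y, (j b <= y /\ y <= j (b + l)%R) ->
     exists y', (j b <= y' /\ y' <= j (b + l)%R) /\ member b E y y') /\
  (forall x1 x2 y1 y2 x1' x2' y1' y2' z z',
     ((j a <= x1 /\ x1 <= j (a + l)%R) /\ (j a <= x2 /\ x2 <= j (a + l)%R)) ->
     ((j b <= y1 /\ y1 <= j (b + l)%R) /\ (j b <= y2 /\ y2 <= j (b + l)%R)) ->
     ((j a <= x1' /\ x1' <= j (a + l)%R) /\ (j a <= x2' /\ x2' <= j (a + l)%R)) ->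
     ((j b <= y1' /\ y1' <= j (b + l)%R) /\ (j b <= y2' /\ y2' <= j (b + l)%R)) ->
     (member a E x1 x1' /\ member a E x2 x2') ->
     (member b E y1 y1' /\ member b E y2 y2') ->
     (D x1 y1 z /\ D x2 y2 z) -> D x1' y1' z' -> D x2' y2' z') /\
  (j a <= E n /\ E n <= j (a + l)%R) /\
  member a E (j a) (j a) /\ member b E (j b) (j b) /\
  member a E (j (a + l)%R) (E n).

Lemma Def_additive_member : Def N0 Q additive_member.
Proof.
have Qj q : Q (j q) by left; exists q.
rewrite /additive_member; def; by apply: Def_member => // [k||]; coord.
Qed.

(** For rational parameters and arguments the images can be taken rational, where [D] is true
    addition; [pexider_linear] then applies. *)
Lemma additive_member_rational (e : nat -> rat) : additive_member (j \o e) ->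
  [/\ (a <= e n <= a + l)%R,
    (forall x, (a <= x <= a + l)%R ->
      exists2 z, (a <= z <= a + l)%R & member a (j \o e) (j x) (j z)) &
    forall x z, (a <= x <= a + l)%R -> (a <= z <= a + l)%R ->
      member a (j \o e) (j x) (j z) -> ((z - a) * l = (x - a) * (e n - a))%R].
Proof.
have [l0 ua av ub bv] := bounds.
have Qj q : Q (j q) by left; exists q.
move=> [A1 [A2 [A3 [[An An'] [Aa [Ab Al]]]]]].
have W1 x : (a <= x <= a + l)%R ->
    exists2 z, (a <= z <= a + l)%R & member a (j \o e) (j x) (j z).
  move=> /andP [ax xa]; have := A1 (j x); rewrite !j_le => /(_ (conj ax xa)) H.
  have [|z [[az za] Hz]] := Def1_rational _ H; last first.
    by exists z; rewrite -?j_le ?az.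
  by rewrite /Def1; def; apply: Def_member => // [k||]; coord.
have W2 y : (b <= y <= b + l)%R ->
    exists2 z, (b <= z <= b + l)%R & member b (j \o e) (j y) (j z).
  move=> /andP [by_ yb]; have := A2 (j y); rewrite !j_le => /(_ (conj by_ yb)) H.
  have [|z [[bz zb] Hz]] := Def1_rational _ H; last first.
    by exists z; rewrite -?j_le ?bz.
  by rewrite /Def1; def; apply: Def_member => // [k||]; coord.
have nI : (a <= e n <= a + l)%R by rewrite -!j_le An.
split=> //.
apply: (pexider_linear (w2 := fun y z => member b (j \o e) (j y) (j z)) l0 W1 W2) => //.
have DI x y : (a <= x <= a + l)%R -> (b <= y <= b + l)%R ->
    D (j x) (j y) (j (x + y)%R).
  by move=> /andP [ax xa] /andP [by_ yb]; apply: Dsum; apply/andP; lra.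
move=> x1 x2 y1 y2 x1' x2' y1' y2' [x1I x2I y1I y2I] [x1'I x2'I y1'I y2'I].
move=> [w1 w2 w3 w4] E.
apply: j_inj; apply: Dfun (DI _ _ x2'I y2'I).
have inI p q r : (p <= q <= r)%R -> j p <= j q /\ j q <= j r.
  by rewrite !j_le => /andP [].
apply: (A3 (j x1) (j x2) (j y1) (j y2) (j x1') (j x2') (j y1') (j y2')
  (j (x1 + y1)%R)); try by split; by [apply: inI|].
- by split; [|rewrite E]; apply: DI.
- exact: DI.
Qed.

End Family.

Lemma real_and_rational_slopes : False.
Proof.
have [l0 ua av ub bv] := bounds.
have Qj q : Q (j q) by left; exists q.
have [lp [_ lpP]] := Def_finite (ex_intro _ (j 0%R) I) DV.
have [|V' DV' V'E] := @Def_par_cat lp (fun e => V (e 0%N) (e 1%N) (e 2)).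
  by apply: lpP => [|c cl]; [exists (j 0%R); left; exists 0%R|right].
pose n := size lp.
have memberE c e x z : member n V' c (cat_env lp e) x z <-> V (j c) x z.
  rewrite (V'E (scons (j c) (scons x (fun=> z)))) /member.
  set e1 := fun k => _; set e2 := cat_env _ _; suff -> : e1 = e2 by [].
  apply: funext => k; rewrite /e1 /e2 !(cat_env_nth x lp).
  by case: ltnP => // kn; rewrite (cat_env_nth x) ltnNge kn.
pose k := (pi^-1 : R)%R.
have VEk c x z : V (j c) x z <->
    to_real z = (ratr c + (to_real x - ratr c) * k)%R := VE c x z.
have k0 : (0 < k)%R by rewrite invr_gt0 pi_gt0.
have k1 : (k <= 1)%R.
  by rewrite invf_le1 ?pi_gt0 // (le_trans _ (pi_ge2 R)) // ler1n.
have l0R : (0 < ratr l :> R)%R by rewrite ltr0q.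
have Vin c x z : V (j c) x z -> j c <= x /\ x <= j (c + l)%R ->
    j c <= z /\ z <= j (c + l)%R.
  rewrite -!le_to_real -!ge_to_real rmorphD /=.
  move=> /VEk -> [cx xc].
  have := mulr_ge0 (_ : 0 <= to_real x - ratr c)%R (ltW k0).
  have := ler_wpM2l (_ : 0 <= to_real x - ratr c)%R k1.
  by rewrite mulr1; split; lra.
have Vc c : V (j c) (j c) (j c) by apply/VEk; rewrite to_real_j subrr mul0r addr0.
(* [us] encodes the slope [1 / pi], as the image of [a + l]. *)
have [us Vus] := Vex a (j (a + l)%R).
have usE : to_real us = (ratr a + ratr l * k)%R.
  by have /VEk := Vus; rewrite to_real_j rmorphD /= addrAC subrr add0r.
have aal : j a <= j (a + l)%R /\ j (a + l)%R <= j (a + l)%R.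
  by rewrite !j_le lexx; split=> //; lra.
have sumN x y : (j a <= x /\ x <= j (a + l)%R) -> (j b <= y /\ y <= j (b + l)%R) ->
    forall z, D x y z <-> to_real z = (to_real x + to_real y)%R.
  move=> [ax xa] [by_ yb].
  have [||_ //] := sum_real DD Dfun Dsum (x := x) (y := y).
    by rewrite (lt_le_trans _ ax) ?(le_lt_trans xa) ?j_lt.
  by rewrite (lt_le_trans _ by_) ?(le_lt_trans yb) ?j_lt.
have cat_lp : cat_env lp (fun=> us) n = us by rewrite (cat_env_nth us) ltnn.
(* The original parameters [lp] give an additive member, made of the dilations of ratio [1 / pi]
   centred at [a] and [b]. *)
have G0 : additive_member n V' (cat_env lp (fun=> us)).
  rewrite /additive_member cat_lp.
  split=> [x xI|]; first by have [z Vz] := Vex a x; exists z; rewrite memberE;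
    split=> //; apply: Vin Vz xI.
  split=> [y yI|]; first by have [z Vz] := Vex b y; exists z; rewrite memberE;
    split=> //; apply: Vin Vz yI.
  split; last by rewrite !memberE; split; [apply: Vin Vus aal|].
  move=> x1 x2 y1 y2 x1' x2' y1' y2' z z' [x1I x2I] [y1I y2I] [x1'I x2'I] [y1'I y2'I].
  rewrite !memberE !VEk => -[E1 E2] [E3 E4] [].
  rewrite !sumN // => E5 E6 ->.
  have E7 : ((to_real x1 - ratr a) * k + (to_real y1 - ratr b) * k =
      (to_real x2 - ratr a) * k + (to_real y2 - ratr b) * k)%R.
    by rewrite -!mulrDl; congr (_ * k)%R; lra.
  by rewrite E1 E2 E3 E4; lra.
pose S x := exists t, size t = n /\ additive_member n V' (cat_env t (fun=> x)).
have DG := Def_additive_member n DV'.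
have Dcat P : Def N0 Q P ->
    Def1 N0 Q (fun x => exists t, size t = n /\ P (cat_env t (fun=> x))).
  move=> DP; apply: (Def_comp (g := fun e _ => e 0%N) _
    (closed_cat (Def_closed N0 Q) n DP)) => m; coord.
(* Otherwise [us] would be a rational [q], and [pi = l / (q - a)]. *)
have usq : ~ Def1 N0 Q (fun x => x = us).
  move=> /Def1_rational [|q qus]; first by exists us.
  apply: (@pi_irrationnal R); exists (l / (q - a))%R => //.
  have E : (ratr q - ratr a = ratr l * k)%R.
    by rewrite -to_real_j qus usE; lra.
  rewrite rmorphM fmorphV rmorphB /= E /k invfM invrK mulrA divff ?mul1r //.
  by rewrite gt_eqF.
(* As [us] is generic, every code in a rational interval around it comes from an additive member. *)
have [c [e [cus [use SI]]]] := Def_generic (Dcat _ DG)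
  (ex_intro _ lp (conj erefl G0)) usq.
have rational_member q P : Def N0 Q P ->
    (exists t, size t = n /\ P (cat_env t (fun=> j q))) ->
    exists t, [/\ size t = n, P (j \o cat_env t (fun=> q)) &
      cat_env t (fun=> q) n = q].
  move=> DP H; have [t [tn Pt]] := Def_rational_cat (e := fun=> q) DP H.
  exists t; rewrite -cat_env_comp; split=> //.
  by rewrite (cat_env_nth q) tn ltnn.
pose s : R := Num.sqrt 2.
have s0 : (0 < s)%R by rewrite sqrtr_gt0.
have s2 : (s ^+ 2 = 2)%R by rewrite sqr_sqrtr.
have ae : (ratr a < ratr e :> R)%R.
  apply: (@lt_trans _ _ (to_real us)); last by rewrite gt_to_real.
  by rewrite usE ltrDl mulr_gt0.
have ce : (ratr c < ratr e :> R)%R by rewrite ltr_rat -j_lt (lt_trans cus).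
(* [r > 0] is chosen so that [m = a + r * sqrt 2] lies strictly between [c] and [e]. *)
have [r [r1 r2]] : exists r,
    (Num.max 0 ((ratr c - ratr a) / s) < ratr r)%R /\
    (ratr r < (ratr e - ratr a) / s)%R.
  apply: ratr_between; rewrite gt_max divr_gt0 ?subr_gt0 //=.
  by rewrite ltr_pM2r ?invr_gt0 // ltrD2r.
move: r1 r2; rewrite gt_max (ltr_pdivrMr _ _ s0) (ltr_pdivlMr _ _ s0) => /andP [r0 cr] re.
pose m : R := (ratr a + ratr r * s)%R.
have cm : (ratr c < m)%R by rewrite /m; lra.
have me : (m < ratr e)%R by rewrite /m; lra.
(* The member of rational code [q] sends [q] to [a + (q - a) ^ 2 / l]. This is below [w] exactly
   when [(q - a) ^ 2 < 2 * r ^ 2], that is, when [q < m]. *)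
pose w := (a + 2 * r ^+ 2 / l)%R.
pose G E := additive_member n V' E /\ exists z,
  (j a <= z /\ z <= j (a + l)%R) /\ z < j w /\ member n V' a E (E n) z.
have DG' : Def N0 Q G.
  rewrite /G; apply: (closed_and (Def_closed N0 Q)) => //.
  by def; apply: Def_member => // [i||]; coord.
pose T x := exists t, size t = n /\ G (cat_env t (fun=> x)).
have DT : Def1 N0 Q T := Dcat _ DG'.
have TE q : j c < j q < j e -> T (j q) <-> (ratr q < m)%R.
  move=> cqe.
  have key : (a <= q)%R -> ((q - a) * (q - a) < (w - a) * l)%R <-> (ratr q < m)%R.
    move=> aq.
    have -> : ((w - a) * l = 2 * r ^+ 2)%R.
      by rewrite /w addrAC subrr add0r divfK // gt_eqF.
    rewrite -(ltr_rat R) -ltrBlDl.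
    rewrite (_ : ratr ((q - a) * (q - a)) = ((ratr q - ratr a) ^+ 2 : R)%R); last first.
      by rewrite rmorphM rmorphB expr2.
    rewrite (_ : ratr (2 * r ^+ 2) = ((ratr r * s) ^+ 2 : R)%R); last first.
      by rewrite exprMn s2 rmorphM rmorphXn /= ratr_nat mulrC.
    rewrite ltr_pXn2r // nnegrE ?subr_ge0 ?ler_rat //.
    by rewrite mulr_ge0 ?(ltW r0) ?(ltW s0).
  have wa z x : ((z - a) * l = x * x)%R -> (z < w)%R <-> (x * x < (w - a) * l)%R.
    by move=> <-; rewrite ltr_pM2r // ltrD2r.
  split=> [/(rational_member _ _ DG') [t [_ [Gt [z [zI [zw mz]]]] tq]]|qm].
    have [qI _ lin] := additive_member_rational DV' Gt.
    have Dz : Def1 N0 Q (fun z => (j a <= z /\ z <= j (a + l)%R) /\ z < j w /\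
        member n V' a (j \o cat_env t (fun=> q)) (j q) z).
      by rewrite /Def1; def; apply: Def_member => // [i||]; coord.
    rewrite /= tq in mz; rewrite tq in qI lin.
    have [|z' [z'I [z'w mz']]] := Def1_rational Dz; first by exists z.
    rewrite !j_le in z'I; rewrite j_lt in z'w.
    apply/key; first by case/andP: qI.
    by apply: (proj1 (wa _ _ (lin q z' qI _ mz')) z'w); apply/andP.
  have [t [tn Gt tq]] := rational_member q _ DG (SI _ cqe).
  have [qI ex lin] := additive_member_rational DV' Gt.
  rewrite tq in qI lin; have [z zI mz] := ex _ qI.
  exists (map j t); rewrite size_map; split=> //.
  rewrite (_ : cat_env _ _ = j \o cat_env t (fun=> q)); last by rewrite -cat_env_comp.
  split=> //; exists (j z); rewrite /= tq !j_le j_lt; split; first exact/andP.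
  split=> //; apply/(wa _ _ (lin _ _ qI zI mz)).
  by apply/key => //; case/andP: qI.
(* [T] is controlled only between [c] and [e]; [A] completes it so that its rational points form the
   cut of [m]. *)
pose A x := x <= j c \/ x < j e /\ T x.
have DA : Def1 N0 Q A by rewrite /Def1 /A; def.
have AE q : A (j q) <-> (ratr q < m)%R.
  rewrite /A j_le j_lt; have [qc|cq] := leP q c.
    split=> _; last by left.
    by apply: le_lt_trans cm; rewrite ler_rat.
  have [qe|eq_] := ltP q e.
    rewrite -TE ?j_lt ?cq //; split=> [[//|[]//]|]; by right.
  split=> [[//|[]//]|qm]; move: (lt_trans qm me).
  by rewrite ltr_rat ltNge eq_.
pose B x := exists y, x < y /\ forall z, x < z /\ z < y -> A z.
have DB : Def1 N0 Q B by rewrite /Def1 /B; def.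
have BE := cut_right (Def_all DA) AE.
have [z zm] := cut_exists (A := B) (Def_all DB) BE.
have DsB : Def1 N0 Q (is_sup B) by rewrite /Def1 /is_sup; def.
(* The supremum of [B] is definable over Q, hence rational, although its real value is [m]. *)
have [|q /(is_sup_cut _ BE)] := Def1_rational DsB.
  by exists z; apply/(is_sup_cut z BE).
rewrite to_real_j => qm.
apply: (@sqr_rat_neq2 ((q - a) / r)%R); apply: (fmorph_inj (@ratr R)).
rewrite rmorphXn fmorph_div rmorphB /= qm /m addrAC subrr add0r.
by rewrite mulrC mulrA mulVf ?mul1r ?s2 ?ratr_nat // gt_eqF.
Qed.
End Contradiction.

End Real.
End Extension.

Theorem theorem3p8 (R : realType) :
  ~ exists (L : language) (M : structure L rat),
      o_minimal_trace M /\ reduct (Qvs_pi R) M.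
Proof.
move=> [L [M [[L0 [d [N [N0 [M0 [j H]]]]]] QM]]].
case: H => [[omin _] emb _ dense [MI _]].
have MT := reduct_trace omin emb dense MI (induced_trace omin emb dense).
have QT := reduct_trace omin emb dense QM MT.
have [V DV [Vex VE]] := dilation_trace omin emb dense QT.
have [D DD [Dfun Dsum]] := sum_trace omin emb dense QT.
have [l [_ lD]] := Def_finite (ex_intro _ (j 0%R) I) DD.
(* Only addition is brought down to rational parameters; those of [V] are kept, to be varied as the
   parameters of the family. *)
have [] := @Def_rational_box _ _ _ _ _ _ omin emb dense l D +%R 0%R 1%R 0%R 1%R;
  rewrite ?ltr01 //.
  by apply: lD => [|c cl]; [exists (j 0%R); left; exists 0%R|right].
move=> D0 [u [v [u' [v' [DD0 D0fun uv uv' D0sum]]]]].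
exact: (real_and_rational_slopes omin emb dense DD0 D0fun uv uv' D0sum DV Vex VE).
Qed.
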